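(* Let $\mathcal{X}\subseteq\mathbb{R}^{d_1}$ be non-empty, closed and convex, and let $f_t,g_t:\mathcal{X}\times\mathbb{R}^{d_2}\to\mathbb{R}$, $t\in[T]$. Assume that for all $t\in[T]$ and all $\mathbf{z}=[\mathbf{x};\mathbf{y}]$, $\mathbf{z}'=[\mathbf{x}';\mathbf{y}']$ in $\mathcal{X}\times\mathbb{R}^{d_2}$: (i) $|f_t(\mathbf{z})-f_t(\mathbf{z}')|\le \ell_{f,0}\|\mathbf{z}-\mathbf{z}'\|$; (ii) $\mathbf{y}\mapsto g_t(\mathbf{x},\mathbf{y})$ is $\mu_g$-strongly convex with $\mu_g>0$; (iii) $\nabla f_t$, $\nabla g_t$, $\nabla^2 g_t$ are Lipschitz continuous in $\mathbf{z}$ with constants $\ell_{f,1},\ell_{g,1},\ell_{g,2}$ respectively; (iv) $\|\mathbf{x}-\mathbf{x}'\|\le D$ for all $\mathbf{x},\mathbf{x}'\in\mathcal{X}$, and the initialization satisfies $\|\mathbf{y}_1-\mathbf{y}_1^*(\mathbf{x}_1)\|\le D'$; (v) the functions $\mathbf{x}\mapsto f_t(\mathbf{x},\mathbf{y}_t^*(\mathbf{x}))$, $t\in[T]$, are $\mu_f$-strongly convex on $\mathcal{X}$, $\mu_f>0$. Run OAGD (with window size $w=1$) with, for all $t\in[T]$, $$\beta_t=\beta=\frac{2}{\ell_{g,1}+\mu_g},\qquad \alpha_t=\frac{2}{\mu_f t},$$ $$K_t=K>\Big\lceil 0.25(\kappa_g+1)\log\Big(\big(\tfrac{24L_{\mathbf{y}}M_f}{\mu_f}\big)^2+2\Big)\Big\rceil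 .$$ Then $$\mathrm{BS\text{-}Reg}_T\le\mathcal{O}\big(\log T+\bar Y_{2,T}\big).$$
   Context: Notation: $[T]=\{1,\dots,T\}$, $\|\cdot\|$ is the Euclidean (or induced operator) norm, $\kappa_g=\ell_{g,1}/\mu_g$. Assumption (iii) implicitly includes that $f_t$ is differentiable and $g_t$ twice differentiable. $\mathbf{y}_t^*(\mathbf{x})=\arg\min_{\mathbf{y}\in\mathbb{R}^{d_2}}g_t(\mathbf{x},\mathbf{y})$. Constants: $L_{\mathbf{y}}=\ell_{g,1}/\mu_g$ and $M_f=\ell_{f,1}+\frac{\ell_{g,1}\ell_{f,1}}{\mu_g}+\frac{\ell_{f,0}}{\mu_g}\big(\ell_{g,2}+\frac{\ell_{g,1}\ell_{g,2}}{\mu_g}\big)$. Approximate hypergradient: $\tilde\nabla f_t(\mathbf{x},\mathbf{y})=\nabla_{\mathbf{x}}f_t(\mathbf{x},\mathbf{y})+\mathbf{M}_t(\mathbf{x},\mathbf{y})\nabla_{\mathbf{y}}f_t(\mathbf{x},\mathbf{y})$, where $\mathbf{M}_t(\mathbf{x},\mathbf{y})\in\mathbb{R}^{d_1\times d_2}$ solves $\mathbf{M}_t(\mathbf{x},\mathbf{y})\nabla^2_{\mathbf{y}}g_t(\mathbf{x},\mathbf{y})+\nabla^2_{\mathbf{x}\mathbf{y}}g_t(\mathbf{x},\mathbf{y})=0$. OAGD (online alternating gradient descent) with $w=1$: start from $(\mathbf{x}_1,\mathbf{y}_1)\in\mathcal{X}\times\mathbb{R}^{d_2}$. For $t=1,\dots,T$: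 set $\mathbf{z}_t^1=\mathbf{y}_t$; for $k=1,\dots,K_t$ set $\mathbf{z}_t^{k+1}=\mathbf{z}_t^k-\beta_t\nabla_{\mathbf{y}}g_t(\mathbf{x}_t,\mathbf{z}_t^k)$; set $\mathbf{y}_{t+1}=\mathbf{z}_t^{K_t+1}$ and $\mathbf{x}_{t+1}=\Pi_{\mathcal{X}}[\mathbf{x}_t-\alpha_t\tilde\nabla f_t(\mathbf{x}_t,\mathbf{y}_{t+1})]$, with $\Pi_{\mathcal{X}}$ the Euclidean projection. Bilevel static regret: with $\mathbf{x}^*\in\arg\min_{\mathbf{x}\in\mathcal{X}}\sum_{t=1}^Tf_t(\mathbf{x},\mathbf{y}_t^*(\mathbf{x}))$, $\mathrm{BS\text{-}Reg}_T=\sum_{t=1}^T\big(f_t(\mathbf{x}_t,\mathbf{y}_t^*(\mathbf{x}_t))-f_t(\mathbf{x}^*,\mathbf{y}_t^*(\mathbf{x}^* ))\big)$. Also $\bar Y_{2,T}=\sum_{t=2}^T\|\mathbf{y}_{t-1}^*(\mathbf{x}^* )-\mathbf{y}_t^*(\mathbf{x}^* )\|^2$. The bound is understood for $T\ge2$; the constant hidden in $\mathcal{O}$ depends only on $\ell_{f,0},\ell_{f,1},\ell_{g,1},\ell_{g,2},\mu_f,\mu_g,D,D'$ and not on $T$ or otherwise on the function sequence. *)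

(* Defs.v *)
From HB Require Import structures.
From mathcomp Require Import all_boot all_order all_algebra.
From mathcomp Require Import all_classical all_reals all_analysis.
Set Implicit Arguments.
Unset Strict Implicit.
Unset Printing Implicit Defensive.
Import Order.TTheory GRing.Theory Num.Theory.
Import numFieldNormedType.Exports.
Local Open Scope classical_set_scope.
Local Open Scope ring_scope.

(* The norm `| _ | that the library puts on matrices is the sup norm, so the
   Euclidean norm and its operator norm are defined here. *)
Definition dot (R : realType) (n : nat) (u v : 'cV[R]_n) : R :=
  \sum_i u i 0 * v i 0.

Definition norm2 (R : realType) (n : nat) (u : 'cV[R]_n) : R :=
  Num.sqrt (dot u u).

Definition opnorm2 (R : realType) (m n : nat) (A : 'M[R]_(m, n)) : R :=
  sup [set norm2 (A *m v) | v in [set v : 'cV[R]_n | norm2 v <= 1]].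

Definition is_minimizer (R : realType) (T : Type) (A : set T) (h : T -> R)
    (a : T) : Prop :=
  A a /\ forall b, A b -> h a <= h b.

Definition strongly_convex (R : realType) (n : nat) (mu : R)
    (A : set 'cV[R]_n) (h : 'cV[R]_n -> R) : Prop :=
  forall u v (s : R), A u -> A v -> 0 <= s <= 1 ->
    h (s *: u + (1 - s) *: v) <=
      s * h u + (1 - s) * h v - mu / 2 * (s * (1 - s)) * norm2 (u - v) ^+ 2.

(* A point z = [x; y] is encoded as col_mx x y.  Functions on X * R^d2 are
   total functions whose values outside this set are never used. *)
Definition cylinder (R : realType) (d1 d2 : nat) (X : set 'cV[R]_d1) :
    set 'cV[R]_(d1 + d2) :=
  [set z | X (usubmx z)].
Arguments cylinder {R d1} d2 X.

(* Frechet differentiability relative to the domain A: only increments that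
   stay in A are tested, so that no value outside A matters, and at interior
   points of A this is ordinary differentiability.  If A has empty interior
   the gradient (resp. Jacobian) is not unique, and what is proved about these
   relations holds for any choice of it, including the one coming from a
   differentiable extension to a neighbourhood of A. *)
Definition gradient_within (R : realType) (n : nat) (A : set 'cV[R]_n)
    (h : 'cV[R]_n -> R) (z G : 'cV[R]_n) : Prop :=
  forall e : R, 0 < e -> \forall w \near within A (nbhs z),
    `|h w - h z - dot G (w - z)| <= e * norm2 (w - z).

(* J i j is the partial derivative of F_i in the j-th variable. *)
Definition jacobian_within (R : realType) (m n : nat) (A : set 'cV[R]_n)
    (F : 'cV[R]_n -> 'cV[R]_m) (z : 'cV[R]_n) (J : 'M[R]_(m, n)) : Prop :=
  forall e : R, 0 < e -> \forall w \near within A (nbhs z),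
    norm2 (F w - F z - J *m (w - z)) <= e * norm2 (w - z).

Section Blocks.
Variables (R : realType) (d1 d2 : nat).

Definition grad_x (G : 'cV[R]_(d1 + d2)) : 'cV[R]_d1 := usubmx G.
Definition grad_y (G : 'cV[R]_(d1 + d2)) : 'cV[R]_d2 := dsubmx G.
Definition hess_xy (H : 'M[R]_(d1 + d2)) : 'M[R]_(d1, d2) := ursubmx H.
Definition hess_yy (H : 'M[R]_(d1 + d2)) : 'M[R]_d2 := drsubmx H.

Definition approx_hypergrad (G : 'cV[R]_(d1 + d2)) (M : 'M[R]_(d1, d2)) :
    'cV[R]_d1 :=
  grad_x G + M *m grad_y G.

(* gradf t z and gradg t z are the gradients of f_t and g_t at z = [x; y], and
   M t z is the matrix M_t(x, y). *)
Definition OAGD_run (X : set 'cV[R]_d1) (T : nat)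
    (gradf gradg : nat -> 'cV[R]_(d1 + d2) -> 'cV[R]_(d1 + d2))
    (M : nat -> 'cV[R]_(d1 + d2) -> 'M[R]_(d1, d2))
    (alpha beta : nat -> R) (K : nat -> nat)
    (x : nat -> 'cV[R]_d1) (y : nat -> 'cV[R]_d2) : Prop :=
  X (x 1%N) /\
  forall t : nat, (1 <= t <= T)%N ->
    y t.+1 = iter (K t)
      (fun z => z - beta t *: grad_y (gradg t (col_mx (x t) z))) (y t) /\
    let z := col_mx (x t) (y t.+1) in
    is_minimizer X
      (fun u => norm2
        (u - (x t - alpha t *: approx_hypergrad (gradf t z) (M t z))))
      (x t.+1).

Definition outer (f : nat -> 'cV[R]_(d1 + d2) -> R)
    (ystar : nat -> 'cV[R]_d1 -> 'cV[R]_d2) (t : nat) (x : 'cV[R]_d1) : R :=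
  f t (col_mx x (ystar t x)).

Definition BSReg (f : nat -> 'cV[R]_(d1 + d2) -> R)
    (ystar : nat -> 'cV[R]_d1 -> 'cV[R]_d2) (x : nat -> 'cV[R]_d1)
    (xstar : 'cV[R]_d1) (T : nat) : R :=
  \sum_(1 <= t < T.+1) (outer f ystar t (x t) - outer f ystar t xstar).

Definition Ybar2 (ystar : nat -> 'cV[R]_d1 -> 'cV[R]_d2)
    (xstar : 'cV[R]_d1) (T : nat) : R :=
  \sum_(2 <= t < T.+1) norm2 (ystar t.-1 xstar - ystar t xstar) ^+ 2.

End Blocks.

Definition kappa_g (R : realType) (lg1 mug : R) : R := lg1 / mug.

Definition L_y (R : realType) (lg1 mug : R) : R := lg1 / mug.

Definition M_f (R : realType) (lf0 lf1 lg1 lg2 mug : R) : R :=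
  lf1 + lg1 * lf1 / mug + lf0 / mug * (lg2 + lg1 * lg2 / mug).

(* Main.v *)
Require Import Defs.
From HB Require Import structures.
From mathcomp Require Import all_boot all_order all_algebra.
From mathcomp Require Import all_classical all_reals all_analysis.
From mathcomp Require Import ring lra.
Set Implicit Arguments.
Unset Strict Implicit.
Unset Printing Implicit Defensive.
Import Order.TTheory GRing.Theory Num.Theory.
Import numFieldNormedType.Exports.
Local Open Scope classical_set_scope.
Local Open Scope ring_scope.

(** Write F_t(x) = f_t(x, ystar_t(x)), a_t = |x_t - xstar|^2, and
    th_t = |y_(t+1) - ystar_t(x_t)|^2 for the squared error of the inner loop.

    The vector h_t used for the step is a perturbed gradient of F_t.  Strong
    convexity of f_t(x, ystar_t(x)) bounds the regret of round t by
    <grad F_t(x_t), x_t - xstar> - (muf / 2) a_t ([outer_above_tangent]), the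
    perturbation costs M_f sqrt(th_t) sqrt(a_t) ([hypergrad_error]), and the
    projected step along h_t costs (a_t - a_(t+1)) / (2 alpha_t) plus
    O(alpha_t) ([projected_step_regret]).  With alpha_t = 2 / (muf t) the
    telescoping terms sum to at most (muf / 4) sum a_t and the terms O(alpha_t)
    form a harmonic sum, hence the log T.  After Young's inequality on the
    cross term ([round_regret]), a multiple of - sum a_t is left over and a
    multiple of sum th_t has to be paid for.

    The inner loop pays for it.  Gradient descent with step 2 / (lg1 + mug)
    contracts by (kappa - 1) / (kappa + 1) ([gd_step_contracts]), and K is
    chosen so that K steps divide the squared distance to ystar_t(x_t) by at
    least B = (24 L M_f / muf)^2 + 2 ([inner_gd_rate]).  By the triangle
    inequality the distance at the start of round t+1 is at most
    sqrt(th_t) + L sqrt(a_t) + |ystar_t(xstar) - ystar_(t+1)(xstar)|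
    + L sqrt(a_(t+1)), because each ystar_t is L-Lipschitz
    ([ystar_lipschitz]).  So sum th_t is bounded by a constant, the path
    variation at xstar, and a multiple of sum a_t that is small enough to be
    absorbed ([regret_recursion]).

    X may have empty interior.  Gradients in x are then determined only up to
    vectors orthogonal to X and can have any norm.  What is bounded is their
    pairing with a difference of two points of X ([hypergrad_feasible_le]), and
    the chain rule for F_t is a one-sided expansion along a segment of X.  That
    expansion replaces the implicit function theorem: the optimality condition grad_y g_t(x, ystar_t(x)) = 0 is
    expanded at nearby points of X, and the equation defining M_t, which
    involves the block xy of the Hessian, is turned into one on the block yx by
    the symmetry of second derivatives ([second_derivative_symm]). *)

(** * Euclidean inner product, norm and operator norm *)
Section Euclidean.
Variable R : realType.
Implicit Types n : nat.

Lemma dotC n (u v : 'cV[R]_n) : dot u v = dot v u.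
Proof. by apply: eq_bigr => i _; rewrite mulrC. Qed.

Lemma dotDl n (u v w : 'cV[R]_n) : dot (u + v) w = dot u w + dot v w.
Proof. by rewrite -big_split; apply: eq_bigr => i _; rewrite mxE mulrDl. Qed.

Lemma dotZl n s (u v : 'cV[R]_n) : dot (s *: u) v = s * dot u v.
Proof. by rewrite mulr_sumr; apply: eq_bigr => i _; rewrite mxE mulrA. Qed.

Lemma dotNl n (u v : 'cV[R]_n) : dot (- u) v = - dot u v.
Proof. by rewrite -scaleN1r dotZl mulN1r. Qed.

Lemma dotBl n (u v w : 'cV[R]_n) : dot (u - v) w = dot u w - dot v w.
Proof. by rewrite dotDl dotNl. Qed.

Lemma dotDr n (u v w : 'cV[R]_n) : dot u (v + w) = dot u v + dot u w.
Proof. by rewrite dotC dotDl !(dotC u). Qed.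

Lemma dotZr n s (u v : 'cV[R]_n) : dot u (s *: v) = s * dot u v.
Proof. by rewrite dotC dotZl dotC. Qed.

Lemma dotNr n (u v : 'cV[R]_n) : dot u (- v) = - dot u v.
Proof. by rewrite dotC dotNl dotC. Qed.

Lemma dot0l n (v : 'cV[R]_n) : dot 0 v = 0.
Proof. by rewrite -(scale0r 0) dotZl mul0r. Qed.

Definition dotE := (dotDl, dotDr, dotNl, dotNr, dotZl, dotZr).

Lemma dot_ge0 n (u : 'cV[R]_n) : 0 <= dot u u.
Proof. by apply: sumr_ge0 => i _; rewrite -expr2 sqr_ge0. Qed.

Lemma norm2_ge0 n (u : 'cV[R]_n) : 0 <= norm2 u.
Proof. exact: sqrtr_ge0. Qed.

Lemma norm2_sqr n (u : 'cV[R]_n) : norm2 u ^+ 2 = dot u u.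
Proof. by rewrite sqr_sqrtr ?dot_ge0. Qed.

Lemma norm2_le n (u : 'cV[R]_n) c : 0 <= c -> dot u u <= c ^+ 2 -> norm2 u <= c.
Proof.
by move=> c0 uc; rewrite -(@ler_pXn2r _ 2) ?nnegrE ?norm2_ge0 ?norm2_sqr.
Qed.

Lemma norm2_eq0 n (u : 'cV[R]_n) : norm2 u = 0 -> u = 0.
Proof.
move=> u0; have : dot u u = 0 by rewrite -norm2_sqr u0 expr0n.
move/eqP; rewrite psumr_eq0; last by move=> i _; rewrite -expr2 sqr_ge0.
move=> /allP h; apply/matrixP => i j; rewrite (ord1 j) mxE.
by have /eqP/eqP := h i (mem_index_enum i); rewrite mulf_eq0 orbb => /eqP.
Qed.

Lemma norm20 n : norm2 (0 : 'cV[R]_n) = 0.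
Proof. by rewrite /norm2 dot0l sqrtr0. Qed.

Lemma norm2Z n s (u : 'cV[R]_n) : norm2 (s *: u) = `|s| * norm2 u.
Proof.
by rewrite /norm2 dotZl dotZr mulrA -expr2 sqrtrM ?sqr_ge0// sqrtr_sqr.
Qed.

Lemma norm2N n (u : 'cV[R]_n) : norm2 (- u) = norm2 u.
Proof. by rewrite -scaleN1r norm2Z normrN1 mul1r. Qed.

Lemma norm2C n (u v : 'cV[R]_n) : norm2 (u - v) = norm2 (v - u).
Proof. by rewrite -norm2N opprB. Qed.

(** Cauchy-Schwarz, from the nonnegativity of the squared norm of
    |v| u - |u| v. *)
Lemma dot_le_norm2 n (u v : 'cV[R]_n) : dot u v <= norm2 u * norm2 v.
Proof.
have [u0|u0] := eqVneq (norm2 u) 0.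
  by rewrite u0 mul0r (norm2_eq0 u0) dot0l.
have [v0|v0] := eqVneq (norm2 v) 0.
  by rewrite v0 mulr0 (norm2_eq0 v0) dotC dot0l.
have pu : 0 < norm2 u by rewrite lt_def u0 norm2_ge0.
have pv : 0 < norm2 v by rewrite lt_def v0 norm2_ge0.
have := dot_ge0 (norm2 v *: u - norm2 u *: v).
rewrite !dotE -!norm2_sqr (dotC v u) => h.
rewrite -(ler_pM2l (mulr_gt0 pu pv)); nra.
Qed.

Lemma norm_dot_le n (u v : 'cV[R]_n) : `|dot u v| <= norm2 u * norm2 v.
Proof.
by rewrite ler_norml dot_le_norm2 andbT lerNl -dotNl -(norm2N u) dot_le_norm2.
Qed.

Lemma norm2D n (u v : 'cV[R]_n) : norm2 (u + v) <= norm2 u + norm2 v.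
Proof.
apply: norm2_le; first by rewrite addr_ge0 ?norm2_ge0.
rewrite !dotE (dotC v u) -!norm2_sqr; have := dot_le_norm2 u v; nra.
Qed.

Lemma norm2_triangle n (u v w : 'cV[R]_n) :
  norm2 (u - w) <= norm2 (u - v) + norm2 (v - w).
Proof. by rewrite -(subrKA v u) norm2D. Qed.

Lemma dot_col_mx m n (a c : 'cV[R]_m) (b d : 'cV[R]_n) :
  dot (col_mx a b) (col_mx c d) = dot a c + dot b d.
Proof.
rewrite /dot big_split_ord; congr (_ + _); apply: eq_bigr => i _.
  by rewrite !col_mxEu.
by rewrite !col_mxEd.
Qed.

Lemma norm2_col_mx0 m n (a : 'cV[R]_m) :
  norm2 (col_mx a (0 : 'cV[R]_n)) = norm2 a.
Proof. by rewrite /norm2 dot_col_mx dot0l addr0. Qed.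

Lemma norm2_col_0mx m n (b : 'cV[R]_n) :
  norm2 (col_mx (0 : 'cV[R]_m) b) = norm2 b.
Proof. by rewrite /norm2 dot_col_mx dot0l add0r. Qed.

Lemma norm2_col_mx_le m n (a : 'cV[R]_m) (b : 'cV[R]_n) :
  norm2 (col_mx a b) <= norm2 a + norm2 b.
Proof.
have -> : col_mx a b = col_mx a 0 + col_mx 0 b.
  by rewrite add_col_mx addr0 add0r.
by apply: (le_trans (norm2D _ _)); rewrite norm2_col_mx0 norm2_col_0mx.
Qed.

Lemma norm2_usubmx m n (z : 'cV[R]_(m + n)) : norm2 (usubmx z) <= norm2 z.
Proof.
apply: norm2_le; rewrite ?norm2_ge0// norm2_sqr -{3 4}(vsubmxK z) dot_col_mx.
by rewrite lerDl dot_ge0.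
Qed.

Lemma norm2_dsubmx m n (z : 'cV[R]_(m + n)) : norm2 (dsubmx z) <= norm2 z.
Proof.
apply: norm2_le; rewrite ?norm2_ge0// norm2_sqr -{3 4}(vsubmxK z) dot_col_mx.
by rewrite lerDr dot_ge0.
Qed.

Lemma coord_le_norm2 n (u : 'cV[R]_n) i : `|u i 0| <= norm2 u.
Proof.
rewrite -(@ler_pXn2r _ 2) ?nnegrE ?norm2_ge0 ?normr_ge0// norm2_sqr.
rewrite real_normK ?num_real//.
rewrite /dot (bigD1 i)//= -expr2 lerDl.
by apply: sumr_ge0 => j _; rewrite -expr2 sqr_ge0.
Qed.

(** Neighbourhoods are those of the sup norm, which is dominated by the
    Euclidean norm. *)
Lemma norm2_ball n (z w : 'cV[R]_n) e :
  0 < e -> norm2 (w - z) < e -> ball z e w.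
Proof.
move=> e0 wz; split=> // i j; rewrite (ord1 j) /ball /= distrC.
apply: le_lt_trans wz; have := coord_le_norm2 (w - z) i.
by rewrite !mxE.
Qed.

(** The Frobenius norm is such a bound; it makes the supremum in [opnorm2]
    one of a bounded set. *)
Lemma norm2_mulmx_bounded m n (A : 'M[R]_(m, n)) :
  exists2 c : R, 0 <= c & forall v : 'cV[R]_n, norm2 (A *m v) <= c * norm2 v.
Proof.
pose c := \sum_i norm2 ((row i A)^T) ^+ 2.
have c0 : 0 <= c by apply: sumr_ge0 => i _; rewrite sqr_ge0.
exists (Num.sqrt c) => [|v]; first exact: sqrtr_ge0.
apply: norm2_le; first by rewrite mulr_ge0 ?sqrtr_ge0 ?norm2_ge0.
rewrite exprMn sqr_sqrtr// mulr_suml; apply: ler_sum => i _.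
have -> : (A *m v) i 0 = dot (row i A)^T v.
  by rewrite mxE; apply: eq_bigr => j _; rewrite !mxE.
rewrite -expr2 -real_normK ?num_real// -exprMn.
by rewrite ler_pXn2r ?nnegrE ?mulr_ge0 ?norm2_ge0 ?normr_ge0// norm_dot_le.
Qed.

Lemma le_opnorm2 m n (A : 'M[R]_(m, n)) (v : 'cV[R]_n) :
  norm2 (A *m v) <= opnorm2 A * norm2 v.
Proof.
have [v0|v0] := eqVneq (norm2 v) 0.
  by rewrite v0 (norm2_eq0 v0) mulmx0 norm20 mulr0.
have pv : 0 < norm2 v by rewrite lt_def v0 norm2_ge0.
have [c c0 cA] := norm2_mulmx_bounded A.
have -> : A *m v = norm2 v *: (A *m ((norm2 v)^-1 *: v)).
  by rewrite -scalemxAr scalerA mulfV// scale1r.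
rewrite norm2Z ger0_norm ?norm2_ge0// mulrC ler_pM2r//.
apply: ub_le_sup; last first.
  exists ((norm2 v)^-1 *: v) => //=.
  by rewrite norm2Z ger0_norm ?invr_ge0 ?norm2_ge0// mulVf.
exists c => _ [w /= w1 <-]; apply: le_trans (cA w) _.
by rewrite -[leRHS]mulr1 ler_wpM2l.
Qed.

(** Coercivity makes the kernel trivial, and a square matrix with trivial
    kernel is onto. *)
Lemma coercive_onto n (mu : R) (A : 'M[R]_n) : 0 < mu ->
  (forall v : 'cV[R]_n, mu * norm2 v ^+ 2 <= dot v (A *m v)) ->
  forall w : 'cV[R]_n, exists2 v, A *m v = w & norm2 v <= norm2 w / mu.
Proof.
move=> mu0 coA.
have bd (v : 'cV[R]_n) : norm2 v <= norm2 (A *m v) / mu.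
  rewrite ler_pdivlMr//.
  have := norm2_ge0 v; rewrite le_eqVlt => /orP[/eqP<-|v0].
    by rewrite mul0r norm2_ge0.
  rewrite -(ler_pM2l v0); have := coA v; have := dot_le_norm2 v (A *m v); nra.
have unitA : A \in unitmx.
  rewrite -unitmx_tr -row_free_unit -kermx_eq0.
  apply/rowV0P => v /sub_kermxP vA.
  have : A *m v^T = 0 by rewrite -[A]trmxK -trmx_mul vA trmx0.
  move=> Av; have := bd v^T; rewrite Av norm20 mul0r => v0.
  have /norm2_eq0 : norm2 v^T = 0 by apply/le_anti; rewrite v0 norm2_ge0.
  by move/(congr1 trmx); rewrite trmxK trmx0.
move=> w; exists (invmx A *m w); first by rewrite mulmxA mulmxV// mul1mx.
by have := bd (invmx A *m w); rewrite mulmxA mulmxV// mul1mx.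
Qed.

End Euclidean.

(** * Derivatives along segments *)
Section Segment.
Variable R : realType.
Implicit Types (s : R) (phi dphi : R -> R).

Lemma gradient_withinP n (A : set 'cV[R]_n) h z G e :
  gradient_within A h z G -> 0 < e ->
  exists2 d, 0 < d & forall w, A w -> norm2 (w - z) < d ->
    `|h w - h z - dot G (w - z)| <= e * norm2 (w - z).
Proof.
move=> hG e0; have /nbhs_ballP[d /= d0 hd] := hG e e0.
by exists d => // w Aw wz; apply: hd => //; apply: norm2_ball.
Qed.

Lemma jacobian_withinP m n (A : set 'cV[R]_n) (F : 'cV[R]_n -> 'cV[R]_m) z J e :
  jacobian_within A F z J -> 0 < e ->
  exists2 d, 0 < d & forall w, A w -> norm2 (w - z) < d ->
    norm2 (F w - F z - J *m (w - z)) <= e * norm2 (w - z).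
Proof.
move=> hJ e0; have /nbhs_ballP[d /= d0 hd] := hJ e e0.
by exists d => // w Aw wz; apply: hd => //; apply: norm2_ball.
Qed.

(** One-sided at both ends of [0, s], so that it also applies to segments that
    start on the boundary of the domain. *)
Definition deriv_on s phi dphi :=
  forall r, 0 <= r <= s -> forall e, 0 < e ->
  exists2 d, 0 < d & forall r', 0 <= r' <= s -> `|r' - r| < d ->
    `|phi r' - phi r - (r' - r) * dphi r| <= e * `|r' - r|.

Lemma deriv_on_MVT s phi dphi : 0 < s -> deriv_on s phi dphi ->
  exists2 c, 0 < c < s & phi s - phi 0 = dphi c * s.
Proof.
move=> s0 dphiP.
have cont (r : R) : 0 <= r <= s -> forall e : R, 0 < e -> exists2 d, 0 < d &
    forall r', 0 <= r' <= s -> `|r' - r| < d -> `|phi r - phi r'| < e.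
  move=> rs e e0; have [d d0 hd] := dphiP r rs 1 ltr01.
  have c0 : 0 < 1 + `|dphi r| by rewrite ltr_pwDl.
  exists (Num.min d (e / (1 + `|dphi r|))); first by rewrite lt_min d0 divr_gt0.
  move=> r' r's; rewrite lt_min => /andP[/(hd r' r's)] + rc.
  rewrite ltr_pdivlMr// in rc; rewrite mul1r => h; rewrite distrC.
  apply: le_lt_trans rc; rewrite -[X in `|X|](subrK ((r' - r) * dphi r)).
  by apply: le_trans (ler_normD _ _) _; rewrite normrM; lra.
have der (r : R) : r \in `]0, s[ -> is_derive r 1 phi (dphi r).
  rewrite in_itv /= => /andP[r0 rs].
  have rs' : 0 <= r <= s by rewrite !ltW.
  suff lim : (fun h => h^-1 *: ((phi \o shift r) (h *: 1) - phi r)) @ 0^' -->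
      dphi r.
    by apply: DeriveDef; [apply/cvg_ex; exists (dphi r)|exact: cvg_lim lim].
  apply/cvgrPdist_le => e e0.
  have [d d0 hd] := dphiP r rs' e e0.
  near=> h.
  have hn0 : h != 0 by near: h; exact: nbhs_dnbhs_neq.
  have h1 : `|h| < d by near: h; exact: dnbhs0_lt.
  have h2 : `|h| < r by near: h; exact: dnbhs0_lt.
  have h3 : `|h| < s - r by near: h; apply: dnbhs0_lt; rewrite subr_gt0.
  move: h2 h3; rewrite !ltr_norml => /andP[h2 h2'] /andP[h3 h3'].
  have := hd (h + r); rewrite addrK => /(_ _ h1).
  have -> : 0 <= h + r <= s by lra.
  move=> /(_ isT) hle; rewrite /= /shift /= [h *: 1]mulr1.
  have hp : 0 < `|h| by rewrite normr_gt0.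
  rewrite -(ler_pM2r hp) -normrM; apply: le_trans hle.
  rewrite -[leRHS]normrN le_eqVlt; apply/orP; left; apply/eqP; congr `|_|.
  have -> : h^-1 *: (phi (h + r) - phi r : R^o) = h^-1 * (phi (h + r) - phi r).
    by [].
  by field.
have ct : {within `[0, s], continuous phi}.
  apply/continuous_within_itvP => //; split.
  - move=> r /der [] /derivable1_diffP + _; exact: differentiable_continuous.
  - apply/cvgrPdist_lt => e e0.
    have [d d0 hd] := cont 0 (introT andP (conj (lexx _) (ltW s0))) e e0.
    near=> r.
    have r0 : 0 < r by near: r; exact: nbhs_right_gt.
    have rd : r < d by near: r; exact: nbhs_right_lt.
    have rs : r < s by near: r; exact: nbhs_right_lt.
    by apply: hd; [rewrite !ltW|rewrite subr0 gtr0_norm].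
  - apply/cvgrPdist_lt => e e0.
    have [d d0 hd] := cont s (introT andP (conj (ltW s0) (lexx _))) e e0.
    near=> r.
    have r0 : 0 < r by near: r; exact: nbhs_left_gt.
    have rs : r < s by near: r; exact: nbhs_left_lt.
    have rd : s - d < r by near: r; apply: nbhs_left_gt; lra.
    by apply: hd; [rewrite !ltW|rewrite ltr_norml; lra].
have [c] := MVT s0 der ct.
by rewrite in_itv subr0 => c0s eq; exists c.
Unshelve. all: by end_near. Qed.

Lemma deriv_onB s phi dphi psi dpsi : deriv_on s phi dphi ->
  deriv_on s psi dpsi ->
  deriv_on s (fun r => phi r - psi r) (fun r => dphi r - dpsi r).
Proof.
move=> h1 h2 r rs e e0; have e20 : 0 < e / 2 by rewrite divr_gt0.
have [d1 d10 {}h1] := h1 r rs _ e20; have [d2 d20 {}h2] := h2 r rs _ e20.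
exists (Num.min d1 d2) => [|r' r's]; first by rewrite lt_min d10.
rewrite lt_min => /andP[/(h1 _ r's) {}h1 /(h2 _ r's) {}h2].
have -> : phi r' - psi r' - (phi r - psi r) - (r' - r) * (dphi r - dpsi r) =
  (phi r' - phi r - (r' - r) * dphi r) - (psi r' - psi r - (r' - r) * dpsi r).
  by ring.
by apply: le_trans (ler_normB _ _) _; lra.
Qed.

Lemma deriv_on_quadratic s b c :
  deriv_on s (fun r => b * r + c * r ^+ 2) (fun r => b + 2 * c * r).
Proof.
move=> r rs e e0; have c0 : 0 < 1 + `|c| by rewrite ltr_pwDl.
exists (e / (1 + `|c|)); first by rewrite divr_gt0.
move=> r' _; rewrite ltr_pdivlMr// => rr'.
have -> : b * r' + c * r' ^+ 2 - (b * r + c * r ^+ 2) -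
  (r' - r) * (b + 2 * c * r) = c * (r' - r) * (r' - r) by ring.
rewrite normrM ler_wpM2r// normrM; have := normr_ge0 (r' - r); nra.
Qed.

Lemma deriv_on_line n (A : set 'cV[R]_n) h (G : 'cV[R]_n -> 'cV[R]_n) z a s :
  (forall r, 0 <= r <= s -> A (z + r *: a)) ->
  (forall w, A w -> gradient_within A h w (G w)) ->
  deriv_on s (fun r => h (z + r *: a)) (fun r => dot (G (z + r *: a)) a).
Proof.
move=> segA hG r rs e e0; have c0 : 0 < 1 + norm2 a.
  by rewrite ltr_pwDl ?norm2_ge0.
have [d d0 hd] := gradient_withinP (hG _ (segA r rs)) (divr_gt0 e0 c0).
exists (d / (1 + norm2 a)) => [|r' r's]; first by rewrite divr_gt0.
rewrite ltr_pdivlMr// => rr'.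
have diff : z + r' *: a - (z + r *: a) = (r' - r) *: a.
  by rewrite opprD addrACA subrr add0r scalerBl.
have := hd _ (segA r' r's); rewrite diff norm2Z dotZr => hd'.
have rd : `|r' - r| * norm2 a < d.
  by apply: le_lt_trans rr'; rewrite ler_wpM2l// lerDr.
apply: le_trans (hd' rd) _.
rewrite mulrAC ler_pdivrMr// -mulrA ler_wpM2l ?(ltW e0)// ler_wpM2l// lerDr//.
Qed.

End Segment.

(** * Symmetry of second derivatives, tangents of strongly convex functions *)
Section Convex.
Variable R : realType.

(** The mean value theorem applied to r |-> h(z + s b + r a) - h(z + r a)
    turns the second difference into s times a difference of gradients in the
    direction a, and the Jacobian at z expands that difference.  The points
    used are those of the parallelogram spanned by a and b only, so a and b
    may be any two directions that are jointly feasible from z. *)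
Lemma second_difference n (A : set 'cV[R]_n) h (G : 'cV[R]_n -> 'cV[R]_n)
    z H a b e :
  (forall w, A w -> gradient_within A h w (G w)) ->
  jacobian_within A G z H ->
  (forall r s, 0 <= r <= 1 -> 0 <= s <= 1 -> A (z + r *: a + s *: b)) ->
  0 < e ->
  exists2 d, 0 < d & forall s, 0 < s <= 1 -> s < d ->
    `|h (z + s *: a + s *: b) - h (z + s *: a) - h (z + s *: b) + h z -
      s ^+ 2 * dot a (H *m b)| <= e * s ^+ 2.
Proof.
move=> hG hH Aab e0.
pose N := 1 + norm2 a + norm2 b.
have [a0 b0] := (norm2_ge0 a, norm2_ge0 b).
have N0 : 0 < N by rewrite /N; lra.
have e'0 : 0 < e / (2 * N ^+ 2) by rewrite divr_gt0// mulr_gt0 ?exprn_gt0.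
have [d d0 hd] := jacobian_withinP hH e'0.
exists (d / N) => [|s /andP[s0 s1]]; first by rewrite divr_gt0.
rewrite ltr_pdivlMr// => sd.
have zE : z = z + 0 *: a + 0 *: b by rewrite !scale0r !addr0.
have seg1 r : 0 <= r <= s -> A (z + s *: b + r *: a).
  by move=> /andP[r0 rs]; rewrite addrAC; apply: Aab; lra.
have seg2 r : 0 <= r <= s -> A (z + r *: a).
  move=> /andP[r0 rs]; rewrite -[X in A X]addr0 -(scale0r b).
  by apply: Aab; rewrite ?lexx ?ler01//; lra.
have [c /andP[c0 cs]] := deriv_on_MVT s0
  (deriv_onB (deriv_on_line seg1 hG) (deriv_on_line seg2 hG)).
rewrite !scale0r !addr0 => mvt.
have cs' : 0 <= c <= s by rewrite !ltW.
set w1 := z + s *: b + c *: a in mvt; set w2 := z + c *: a in mvt.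
have w1z : w1 - z = s *: b + c *: a by apply/matrixP => i j; rewrite !mxE; ring.
have w2z : w2 - z = c *: a by apply/matrixP => i j; rewrite !mxE; ring.
have n1 : norm2 (w1 - z) <= s * N.
  rewrite w1z; apply: le_trans (norm2D _ _) _.
  rewrite !norm2Z !gtr0_norm// /N; nra.
have n2 : norm2 (w2 - z) <= s * N.
  rewrite w2z norm2Z gtr0_norm// /N; nra.
have {}n1' := hd w1 (seg1 c cs') (le_lt_trans n1 sd).
have {}n2' := hd w2 (seg2 c cs') (le_lt_trans n2 sd).
set e' := e / _ in n1' n2' e'0.
have e'N : e' * (2 * N ^+ 2) = e.
  by rewrite /e' mulfVK// mulf_neq0 ?expf_neq0 ?gt_eqF.
have nd : norm2 (G w1 - G w2 - s *: (H *m b)) <= 2 * (e' * (s * N)).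
  have -> : G w1 - G w2 - s *: (H *m b) =
      (G w1 - G z - H *m (w1 - z)) - (G w2 - G z - H *m (w2 - z)).
    rewrite w1z w2z mulmxDr -!scalemxAr.
    by apply/matrixP => i j; rewrite !mxE; ring.
  apply: le_trans (norm2D _ _) _; rewrite norm2N.
  have := ler_wpM2l (ltW e'0) n1; have := ler_wpM2l (ltW e'0) n2; lra.
have -> : h (z + s *: a + s *: b) - h (z + s *: a) - h (z + s *: b) + h z -
    s ^+ 2 * dot a (H *m b) = s * dot (G w1 - G w2 - s *: (H *m b)) a.
  rewrite (addrAC z) !dotBl dotZl mulrBr (dotC a) mulrC.
  by rewrite [s * (_ - _)]mulrC -mvt; ring.
rewrite normrM gtr0_norm//.
apply: le_trans (ler_wpM2l (ltW s0) (norm_dot_le _ _)) _.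
have aN : norm2 a <= N by rewrite /N; lra.
have := ler_pM (norm2_ge0 _) a0 nd aN => /(ler_wpM2l (ltW s0)) {}nd.
apply: le_trans nd _; rewrite -e'N le_eqVlt; apply/orP; left; apply/eqP; ring.
Qed.

(** The second difference does not change when a and b are exchanged. *)
Lemma second_derivative_symm n (A : set 'cV[R]_n) h (G : 'cV[R]_n -> 'cV[R]_n)
    z H a b :
  (forall w, A w -> gradient_within A h w (G w)) ->
  jacobian_within A G z H ->
  (forall r s, 0 <= r <= 1 -> 0 <= s <= 1 -> A (z + r *: a + s *: b)) ->
  dot a (H *m b) = dot b (H *m a).
Proof.
move=> hG hH Aab.
have Aba r s : 0 <= r <= 1 -> 0 <= s <= 1 -> A (z + r *: b + s *: a).
  by move=> r1 s1; rewrite addrAC; apply: Aab.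
apply/eqP; rewrite -subr_eq0 -normr_le0; apply/ler_addgt0Pr => e e0.
rewrite add0r; have e20 : 0 < e / 2 by rewrite divr_gt0.
have [d1 d10 h1] := second_difference hG hH Aab e20.
have [d2 d20 h2] := second_difference hG hH Aba e20.
have m0 : 0 < Num.min 1 (Num.min d1 d2) by rewrite !lt_min ltr01 d10.
pose s := Num.min 1 (Num.min d1 d2) / 2.
have s0 : 0 < s by rewrite divr_gt0.
have : s < Num.min 1 (Num.min d1 d2) by rewrite /s; lra.
rewrite !lt_min => /and3P[s1 sd1 sd2].
have s01 : 0 < s <= 1 by rewrite s0 ltW.
have := h1 s s01 sd1; have := h2 s s01 sd2.
rewrite (addrAC z (s *: b)) => k2 k1.
rewrite -(ler_pM2l (exprn_gt0 2 s0)).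
rewrite -[X in X * `|_|]ger0_norm ?exprn_ge0 ?(ltW s0)// -normrM.
move: k1 k2; rewrite !ler_norml; lra.
Qed.

(** The number c plays the role of the derivative of h at u in the direction
    v - u; a lower bound on the one-sided difference quotients is enough. *)
Lemma strongly_convex_above_tangent n mu (A : set 'cV[R]_n) h u v c :
  strongly_convex mu A h -> A u -> A v ->
  (forall e, 0 < e -> exists2 d, 0 < d & forall s, 0 < s <= 1 -> s < d ->
     s * (c - e) <= h (u + s *: (v - u)) - h u) ->
  h u + c + mu / 2 * norm2 (v - u) ^+ 2 <= h v.
Proof.
move=> sch Au Av hc; apply/ler_addgt0Pr => e e0.
have e20 : 0 < e / 2 by rewrite divr_gt0.
have [d d0 hd] := hc _ e20.
set N := mu / 2 * _.
have N0 : 0 < 2 * (1 + `|N|) by rewrite mulr_gt0// ltr_pwDl.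
have m0 : 0 < Num.min 1 (Num.min d (e / (1 + `|N|))).
  by rewrite !lt_min ltr01 d0 divr_gt0// ltr_pwDl.
pose s := Num.min 1 (Num.min d (e / (1 + `|N|))) / 2.
have s0 : 0 < s by rewrite divr_gt0.
have : s * 2 <= Num.min 1 (Num.min d (e / (1 + `|N|))) by rewrite /s; lra.
rewrite !le_min => /and3P[s1 sd]; rewrite ler_pdivlMr ?ltr_pwDl// => sN.
have s01 : 0 < s <= 1 by rewrite s0; lra.
have hs : s * (c - e / 2) <= h (u + s *: (v - u)) - h u by apply: hd => //; lra.
have s01' : 0 <= s <= 1 by lra.
have := sch v u s Av Au s01'.
have -> : s *: v + (1 - s) *: u = u + s *: (v - u).
  by apply/matrixP => i j; rewrite !mxE; ring.
move=> le1.
have NE : mu / 2 * (s * (1 - s)) * norm2 (v - u) ^+ 2 = s * (1 - s) * N.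
  by rewrite /N; ring.
rewrite NE in le1.
have sN' : s * N <= e / 2 by have := ler_norm N; nra.
rewrite -(ler_pM2l s0); nra.
Qed.

Lemma gradient_within_lower n (A : set 'cV[R]_n) h u v G e :
  gradient_within A h u G ->
  (forall s, 0 <= s <= 1 -> A (u + s *: (v - u))) -> 0 < e ->
  exists2 d, 0 < d & forall s, 0 < s <= 1 -> s < d ->
    `|h (u + s *: (v - u)) - h u - s * dot G (v - u)| <= s * e.
Proof.
move=> hG Auv e0; have N0 : 0 < 1 + norm2 (v - u).
  by rewrite ltr_pwDl ?norm2_ge0.
have [d d0 hd] := gradient_withinP hG (divr_gt0 e0 N0).
exists (d / (1 + norm2 (v - u))) => [|s /andP[s0 s1]]; first exact: divr_gt0.
rewrite ltr_pdivlMr// => sd.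
have s01 : 0 <= s <= 1 by rewrite (ltW s0).
have diff : u + s *: (v - u) - u = s *: (v - u) by rewrite addrAC subrr add0r.
have lt1 : s * norm2 (v - u) < d by nra.
have := hd _ (Auv s s01); rewrite diff norm2Z dotZr gtr0_norm//.
move=> /(_ lt1) /le_trans; apply.
by rewrite mulrAC ler_pdivrMr//; have := mulr_gt0 s0 e0; lra.
Qed.

End Convex.

(** * Gradient descent on a smooth strongly convex function *)
Section GradientDescent.
Variables (R : realType) (n : nat) (mu L : R).
Variables (q : 'cV[R]_n -> R) (Q : 'cV[R]_n -> 'cV[R]_n) (ystar : 'cV[R]_n).
Hypotheses (mu0 : 0 < mu) (L0 : 0 <= L).
Hypothesis grad_q : forall w, gradient_within setT q w (Q w).
Hypothesis sc_q : strongly_convex mu setT q.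
Hypothesis lip_Q : forall w w', norm2 (Q w - Q w') <= L * norm2 (w - w').
Hypothesis min_q : is_minimizer setT q ystar.

Lemma q_above_tangent u v :
  q u + dot (Q u) (v - u) + mu / 2 * norm2 (v - u) ^+ 2 <= q v.
Proof.
apply: (strongly_convex_above_tangent sc_q) => // e e0.
have [d d0 hd] := gradient_within_lower (v := v) (grad_q u) (fun _ _ => I) e0.
exists d => // s s01 sd; have := hd s s01 sd; rewrite ler_norml; lra.
Qed.

(** The difference of the two sides, along the segment from u to v, has a
    nonpositive derivative by the Lipschitz bound on Q. *)
Lemma descent_lemma u v :
  q v <= q u + dot (Q u) (v - u) + L / 2 * norm2 (v - u) ^+ 2.
Proof.
set b := dot _ _; set c := L / 2 * _.
have /= := deriv_on_MVT ltr01 (deriv_onB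
  (deriv_on_line (fun r _ => I) (fun w _ => grad_q w))
  (deriv_on_quadratic b c)).
move=> /(_ u (v - u)) [r /andP[r0 r1]].
rewrite !scale1r !scale0r (addrC u (v - u)) subrK addr0 expr0n /= !mulr0.
have : dot (Q (u + r *: (v - u)) - Q u) (v - u) <= 2 * c * r.
  apply: le_trans (dot_le_norm2 _ _) _.
  apply: le_trans (ler_wpM2r (norm2_ge0 _) (lip_Q _ _)) _.
  rewrite (addrC u) addrK norm2Z gtr0_norm//.
  by rewrite /c le_eqVlt; apply/orP; left; apply/eqP; field.
by rewrite dotBl -/b expr1n; lra.
Qed.

Lemma strongly_monotone u v :
  mu * norm2 (v - u) ^+ 2 <= dot (Q v - Q u) (v - u).
Proof.
have := q_above_tangent u v; have := q_above_tangent v u.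
by rewrite (norm2C u) -(opprB v u) dotNr dotBl; lra.
Qed.

(** The sharp inequality for mu-strongly convex, L-smooth functions.  The
    function q - (mu / 2) |.|^2 is convex and its gradient P satisfies the
    descent lemma with constant L - mu; comparing its tangent at u' with its
    upper model at v', at the point v' - c (P v' - P u'), and adding the same
    with u and v exchanged gives the cocoercivity of P.  The optimal step is
    c = 1 / (L - mu); when L = mu, arbitrarily large c show that P is
    constant. *)
Lemma cocoercivity u v :
  norm2 (Q v - Q u) ^+ 2 + mu * L * norm2 (v - u) ^+ 2 <=
  (L + mu) * dot (Q v - Q u) (v - u).
Proof.
have [uv|uv] := eqVneq (norm2 (v - u)) 0.
  have /eqP := norm2_eq0 uv; rewrite subr_eq0 => /eqP ->.
  by rewrite !subrr norm20 dot0l expr0n !mulr0 addr0.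
have e0 : 0 < norm2 (v - u) by rewrite lt_def uv norm2_ge0.
have muL : mu <= L.
  have := le_trans (strongly_monotone u v) (dot_le_norm2 _ _).
  have := ler_wpM2r (norm2_ge0 (v - u)) (lip_Q v u).
  move=> h1 h2; have := le_trans h2 h1.
  by rewrite -mulrA -expr2 ler_pM2r// exprn_gt0.
pose P w := Q w - mu *: w.
have half u' v' c : dot (P u') (v' - u') + q u' - mu / 2 * dot u' u' -
    (q v' - mu / 2 * dot v' v') <=
    ((L - mu) / 2 * c ^+ 2 - c) * dot (P v' - P u') (P v' - P u').
  set D := P v' - P u'; pose w := v' - c *: D.
  have := q_above_tangent u' w; have := descent_lemma v' w.
  have wv : w - v' = - (c *: D).
    by apply/matrixP => i j; rewrite !mxE; ring.
  rewrite !norm2_sqr wv {wv}; move: (q w) => qw; rewrite /w {w}.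
  have PE x : Q x = P x + mu *: x by rewrite /P subrK.
  rewrite !PE /D; move: (P u') (P v') => p p'; rewrite !dotE.
  rewrite (dotC p' p) (dotC p' v') (dotC p u') (dotC p v') (dotC p' u').
  rewrite (dotC v' u').
  nra.
pose d := dot (P v - P u) (P v - P u).
have both c : (2 * c - (L - mu) * c ^+ 2) * d <= dot (P v - P u) (v - u).
  have := half u v c; have := half v u c.
  have -> : dot (P u - P v) (P u - P v) = d.
    by rewrite -(opprB (P v)) dotNl dotNr opprK.
  by rewrite -/d dotBl -(opprB v u) dotNr; lra.
have key : d <= (L - mu) * dot (P v - P u) (v - u).
  have [Lmu|Lmu] := eqVneq L mu.
    rewrite Lmu subrr mul0r leNgt; apply/negP => d0.
    pose t := (`|dot (P v - P u) (v - u)| + 1) / d / 2.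
    have tE : 2 * t * d = `|dot (P v - P u) (v - u)| + 1.
      by rewrite /t; field; rewrite gt_eqF.
    have := both t; rewrite Lmu subrr mul0r subr0 tE.
    by have := ler_norm (dot (P v - P u) (v - u)); lra.
  have Lm : 0 < L - mu by rewrite subr_gt0 lt_def Lmu.
  have := both (L - mu)^-1; rewrite expr2 mulrA mulfV ?gt_eqF// mul1r.
  have -> : 2 * (L - mu)^-1 - (L - mu)^-1 = (L - mu)^-1 by ring.
  by rewrite ler_pdivrMl.
move: key; rewrite /d /P.
have -> : Q v - mu *: v - (Q u - mu *: u) = (Q v - Q u) - mu *: (v - u).
  by apply/matrixP => i j; rewrite !mxE; ring.
rewrite !norm2_sqr; move: (Q v - Q u) (v - u) => x y.
by rewrite !dotE (dotC y x); nra.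
Qed.

(** Otherwise a step of length 1 / (L + 1) against the gradient would decrease
    q, by the descent lemma. *)
Lemma gradient_at_minimizer : Q ystar = 0.
Proof.
apply: norm2_eq0; apply/eqP; rewrite -sqrf_eq0; apply/eqP/le_anti.
rewrite sqr_ge0 andbT.
have L1 : 0 < L + 1 by rewrite ltr_wpDl.
pose t := (L + 1)^-1; have t0 : 0 < t by rewrite invr_gt0.
have tL : t * (L + 1) = 1 by rewrite mulVf// gt_eqF.
have := descent_lemma ystar (ystar - t *: Q ystar).
have := min_q.2 (ystar - t *: Q ystar) I.
have -> : ystar - t *: Q ystar - ystar = - (t *: Q ystar).
  by apply/matrixP => i j; rewrite !mxE; ring.
rewrite norm2N norm2Z gtr0_norm// dotNr dotZr -norm2_sqr.
move: (norm2 _) => N h1 h2.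
have {h1 h2} : t * N ^+ 2 <= L / 2 * (t * N) ^+ 2 by lra.
have -> : L / 2 * (t * N) ^+ 2 = t * (N ^+ 2 * ((t * L) / 2)) by ring.
by rewrite ler_pM2l// => h; have := sqr_ge0 N; nra.
Qed.

Definition gd_step v := v - (2 / (L + mu)) *: Q v.

(** For the step 2 / (L + mu) the term |Q v|^2 has the same coefficient in the
    expansion of the square and in [cocoercivity], and cancels. *)
Lemma gd_step_contracts v :
  norm2 (gd_step v - ystar) ^+ 2 <=
  ((L - mu) / (L + mu)) ^+ 2 * norm2 (v - ystar) ^+ 2.
Proof.
have := cocoercivity ystar v; rewrite gradient_at_minimizer subr0.
have Lm : 0 < L + mu by rewrite ltr_wpDl.
have -> : gd_step v - ystar = (v - ystar) - (2 / (L + mu)) *: Q v.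
  by rewrite /gd_step addrAC.
move: (v - ystar) (Q v) => e p.
rewrite !norm2_sqr (dotC p e) => h.
have -> : dot (e - (2 / (L + mu)) *: p) (e - (2 / (L + mu)) *: p) =
    dot e e - 2 * (2 / (L + mu)) * dot e p + (2 / (L + mu)) ^+ 2 * dot p p.
  by rewrite !dotE (dotC p e); ring.
rewrite -subr_ge0.
have -> : ((L - mu) / (L + mu)) ^+ 2 * dot e e -
   (dot e e - 2 * (2 / (L + mu)) * dot e p + (2 / (L + mu)) ^+ 2 * dot p p) =
   4 / (L + mu) ^+ 2 * ((L + mu) * dot e p - (dot p p + mu * L * dot e e)).
  by field; rewrite gt_eqF.
apply: mulr_ge0; last by rewrite subr_ge0.
by apply: divr_ge0 => //; exact: sqr_ge0.
Qed.

Lemma gd_iter_contracts K v :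
  norm2 (iter K gd_step v - ystar) ^+ 2 <=
  ((L - mu) / (L + mu)) ^+ (2 * K) * norm2 (v - ystar) ^+ 2.
Proof.
elim: K => [|K IH]; first by rewrite muln0 expr0 mul1r.
rewrite iterS; apply: le_trans (gd_step_contracts _) _.
rewrite mulnS exprD -mulrA; apply: ler_wpM2l => //; exact: sqr_ge0.
Qed.

(** With kappa = L / mu, the contraction factor is 1 - 2 / (kappa + 1), which
    is at most exp(- 2 / (kappa + 1)).  If L < mu the space is trivial. *)
Lemma gd_iter_rate K v B : 0 < B -> 4^-1 * (L / mu + 1) * ln B <= K%:R ->
  B * norm2 (iter K gd_step v - ystar) ^+ 2 <= norm2 (v - ystar) ^+ 2.
Proof.
move=> B0 hK.
have [muL|Lmu] := leP mu L; last first.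
  have z w : norm2 (w - ystar) = 0.
    have := le_trans (strongly_monotone ystar w) (dot_le_norm2 _ _).
    move=> /le_trans /(_ (ler_wpM2r (norm2_ge0 _) (lip_Q _ _))).
    rewrite -mulrA -expr2 => h; apply/eqP; rewrite eq_le norm2_ge0 andbT leNgt.
    by apply/negP => /(exprn_gt0 2); nra.
  by rewrite !z expr0n mulr0.
have Lm : 0 < L + mu by rewrite ltr_wpDl.
set rho := (L - mu) / (L + mu).
have rho0 : 0 <= rho by rewrite divr_ge0 ?subr_ge0// ltW.
have rhoE : rho <= expR (- (2 * mu / (L + mu))).
  apply: le_trans (expR_ge1Dx _).
  rewrite le_eqVlt; apply/orP; left; apply/eqP; rewrite /rho; field.
  by rewrite gt_eqF.
have rhoK : rho ^+ (2 * K) <= B^-1.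
  apply: (@le_trans _ _ (expR (- (2 * mu / (L + mu))) ^+ (2 * K))).
    by rewrite lerXn2r ?nnegrE ?expR_ge0.
  rewrite -expRM_natl -(lnK B0) -expRN ler_expR mulrN lerN2.
  have c0 : 0 < 4^-1 * (L / mu + 1).
    by rewrite mulr_gt0// ltr_pwDr// divr_ge0// ltW.
  move: hK; rewrite -ler_pdivlMl// => /le_trans; apply.
  rewrite le_eqVlt; apply/orP; left; apply/eqP; rewrite natrM; field.
  by rewrite !gt_eqF.
rewrite -ler_pdivlMl//; apply: le_trans (gd_iter_contracts _ _) _.
by rewrite ler_wpM2r ?sqr_ge0.
Qed.

End GradientDescent.

(** * Directional consequences of Lipschitz bounds *)
Section Directional.
Variable R : realType.

(** A single small s is enough for the bounds that follow, which are
    homogeneous in s. *)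
Lemma jacobian_direction m n (A : set 'cV[R]_n) (F : 'cV[R]_n -> 'cV[R]_m)
    z J a e :
  jacobian_within A F z J -> (forall s, 0 <= s <= 1 -> A (z + s *: a)) ->
  0 < e ->
  exists2 s, 0 < s <= 1 & norm2 (F (z + s *: a) - F z - s *: (J *m a)) <= s * e.
Proof.
move=> hJ Aa e0; have N0 : 0 < 1 + norm2 a by rewrite ltr_pwDl ?norm2_ge0.
have [d d0 hd] := jacobian_withinP hJ (divr_gt0 e0 N0).
have m0 : 0 < Num.min 1 (d / (1 + norm2 a)) by rewrite lt_min ltr01 divr_gt0.
pose s := Num.min 1 (d / (1 + norm2 a)) / 2.
have s0 : 0 < s by rewrite divr_gt0.
have : s * 2 <= Num.min 1 (d / (1 + norm2 a)) by rewrite /s; lra.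
rewrite le_min ler_pdivlMr// => /andP[s1 sd].
have s01 : 0 <= s <= 1 by lra.
exists s; first by lra.
have diff : z + s *: a - z = s *: a by rewrite addrAC subrr add0r.
have lt1 : s * norm2 a < d by nra.
have := hd _ (Aa s s01); rewrite diff -scalemxAr norm2Z gtr0_norm//.
move=> /(_ lt1) /le_trans; apply.
by rewrite mulrAC ler_pdivrMr//; have := mulr_gt0 s0 e0; lra.
Qed.

Lemma jacobian_direction_le m n (A : set 'cV[R]_n) (F : 'cV[R]_n -> 'cV[R]_m)
    z J a L :
  jacobian_within A F z J -> (forall s, 0 <= s <= 1 -> A (z + s *: a)) ->
  (forall w, A w -> norm2 (F w - F z) <= L * norm2 (w - z)) ->
  norm2 (J *m a) <= L * norm2 a.
Proof.
move=> hJ Aa lipF; apply/ler_addgt0Pr => e e0.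
have [s /andP[s0 s1] hs] := jacobian_direction hJ Aa e0.
have s01 : 0 <= s <= 1 by rewrite ltW.
have := lipF _ (Aa s s01).
have -> : z + s *: a - z = s *: a by rewrite addrAC subrr add0r.
rewrite norm2Z gtr0_norm// => l.
rewrite -(ler_pM2l s0) -{1}(gtr0_norm s0) -norm2Z.
have := norm2_triangle (s *: (J *m a)) (F (z + s *: a) - F z) 0.
by rewrite !subr0 norm2C; lra.
Qed.

Lemma gradient_direction_le n (A : set 'cV[R]_n) h z G a L :
  gradient_within A h z G -> (forall s, 0 <= s <= 1 -> A (z + s *: a)) ->
  (forall w, A w -> `|h w - h z| <= L * norm2 (w - z)) ->
  `|dot G a| <= L * norm2 a.
Proof.
move=> hG Aa liph; apply/ler_addgt0Pr => e e0.
have az : z + a - z = a by rewrite addrAC subrr add0r.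
have Aa' s : 0 <= s <= 1 -> A (z + s *: (z + a - z)) by rewrite az; exact: Aa.
have [d d0 hd] := gradient_within_lower hG Aa' e0; rewrite az in hd.
pose s := Num.min 1 d / 2.
have m0 : 0 < Num.min 1 d by rewrite lt_min ltr01.
have s0 : 0 < s by rewrite divr_gt0.
have : s * 2 <= Num.min 1 d by rewrite /s; lra.
rewrite le_min => /andP[s1 sd].
have s01 : 0 <= s <= 1 by lra.
have s01' : 0 < s <= 1 by lra.
have sd' : s < d by lra.
have := hd s s01' sd'; have := liph _ (Aa s s01).
have -> : z + s *: a - z = s *: a by rewrite addrAC subrr add0r.
rewrite norm2Z (gtr0_norm s0) => l1 l2.
rewrite -(ler_pM2l s0) -{1}(gtr0_norm s0) -normrM.
by move: l1 l2; rewrite !ler_norml; lra.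
Qed.

End Directional.

(** * One projected gradient step *)
Section ProjectedStep.
Variables (R : realType) (n : nat) (X : set 'cV[R]_n).
Hypothesis segX : forall u u' (s : R), X u -> X u' -> 0 <= s <= 1 ->
  X (u + s *: (u' - u)).

(** First order optimality of the projection u of p, obtained by moving from u
    towards w by a small step s. *)
Lemma projection_obtuse p u w :
  is_minimizer X (fun v => norm2 (v - p)) u -> X w -> dot (p - u) (w - u) <= 0.
Proof.
move=> [Xu minu] Xw; apply/ler_addgt0Pr => e e0; rewrite add0r.
have N0 : 0 < 1 + norm2 (w - u) ^+ 2 by rewrite ltr_pwDl ?sqr_ge0.
have m0 : 0 < Num.min 1 (e / (1 + norm2 (w - u) ^+ 2)).
  by rewrite lt_min ltr01 divr_gt0.
pose s := Num.min 1 (e / (1 + norm2 (w - u) ^+ 2)).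
have s0 : 0 < s by [].
have : s <= Num.min 1 (e / (1 + norm2 (w - u) ^+ 2)) by [].
rewrite le_min ler_pdivlMr// => /andP[s1 se].
have s01 : 0 <= s <= 1 by rewrite ltW.
have := minu _ (segX Xu Xw s01).
have -> : u + s *: (w - u) - p = s *: (w - u) - (p - u).
  by apply/matrixP => i j; rewrite !mxE; ring.
rewrite (norm2C u p) -(@ler_pXn2r _ 2) ?nnegrE ?norm2_ge0// !norm2_sqr.
rewrite norm2_sqr in se.
move: (w - u) (p - u) se => b a se.
have -> : dot (s *: b - a) (s *: b - a) =
    s ^+ 2 * dot b b - 2 * s * dot a b + dot a a.
  by rewrite !dotE (dotC b a); ring.
move=> h; have {}h : s * (2 * dot a b) <= s * (s * dot b b) by lra.
by rewrite ler_pM2l// in h; lra.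
Qed.

(** G bounds the pairing of h with x' - x rather than the norm of h, because
    the pairing is all that is controlled when X has empty interior. *)
Lemma projected_step_regret (alpha G : R) (x x' h w : 'cV[R]_n) :
  0 < alpha -> X x ->
  is_minimizer X (fun u => norm2 (u - (x - alpha *: h))) x' ->
  `|dot h (x' - x)| <= G * norm2 (x' - x) -> X w ->
  dot h (x - w) <= (norm2 (x - w) ^+ 2 - norm2 (x' - w) ^+ 2) / (2 * alpha) +
    alpha * G ^+ 2 / 2.
Proof.
move=> a0 Xx proj hG Xw.
have := projection_obtuse proj Xw.
have -> : x - alpha *: h - x' = (x - w) - (x' - w) - alpha *: h.
  by apply/matrixP => i j; rewrite !mxE; ring.
have -> : w - x' = - (x' - w) by rewrite opprB.
move: hG; have -> : x' - x = (x' - w) - (x - w).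
  by apply/matrixP => i j; rewrite !mxE; ring.
have := norm2_sqr ((x' - w) - (x - w)).
move: (norm2 ((x' - w) - (x - w))) => N.
rewrite !norm2_sqr; move: (x' - w) (x - w) => a b.
rewrite !dotE (dotC a b) ler_norml => NE /andP[hG _] obt.
rewrite -(ler_pM2l (mulr_gt0 (ltr0Sn R 1) a0)).
have -> : 2 * alpha * ((dot b b - dot a a) / (2 * alpha) + alpha * G ^+ 2 / 2) =
    dot b b - dot a a + (alpha * G) ^+ 2.
  by field; rewrite gt_eqF.
have := sqr_ge0 (N - alpha * G).
have := ler_wpM2l (ltW a0) hG.
nra.
Qed.

End ProjectedStep.

(** * The hypergradient of one bilevel problem *)
Section Bilevel.
Variables (R : realType) (d1 d2 : nat) (lf0 lf1 lg1 lg2 muf mug : R).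
Variables (X : set 'cV[R]_d1) (f g : 'cV[R]_(d1 + d2) -> R).
Variables (gradf gradg : 'cV[R]_(d1 + d2) -> 'cV[R]_(d1 + d2)).
Variables (hessg : 'cV[R]_(d1 + d2) -> 'M[R]_(d1 + d2)).
Variables (M : 'cV[R]_(d1 + d2) -> 'M[R]_(d1, d2)).
Variables (ystar : 'cV[R]_d1 -> 'cV[R]_d2).
Let A := cylinder d2 X.
(** The Lipschitz constant of the solution map [ystar]. *)
Let L := lg1 / mug.
Hypotheses (lf0_ge0 : 0 <= lf0) (lg1_ge0 : 0 <= lg1) (lg2_ge0 : 0 <= lg2).
Hypothesis mug_gt0 : 0 < mug.
Hypothesis segX : forall u u' (s : R), X u -> X u' -> 0 <= s <= 1 ->
  X (u + s *: (u' - u)).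
Hypothesis grad_f : forall z, A z -> gradient_within A f z (gradf z).
Hypothesis grad_g : forall z, A z -> gradient_within A g z (gradg z).
Hypothesis hess_g : forall z, A z -> jacobian_within A gradg z (hessg z).
Hypothesis ystarP : forall u, X u ->
  is_minimizer setT (fun v => g (col_mx u v)) (ystar u).
Hypothesis M_eq : forall z, A z ->
  M z *m hess_yy (hessg z) + hess_xy (hessg z) = 0.
Hypothesis lip_f : forall z z', A z -> A z' ->
  `|f z - f z'| <= lf0 * norm2 (z - z').
Hypothesis sc_g : forall u, X u ->
  strongly_convex mug setT (fun v => g (col_mx u v)).
Hypothesis lip_gradf : forall z z', A z -> A z' ->
  norm2 (gradf z - gradf z') <= lf1 * norm2 (z - z').
Hypothesis lip_gradg : forall z z', A z -> A z' ->
  norm2 (gradg z - gradg z') <= lg1 * norm2 (z - z').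
Hypothesis lip_hessg : forall z z', A z -> A z' ->
  opnorm2 (hessg z - hessg z') <= lg2 * norm2 (z - z').

Let Gy u v := grad_y (gradg (col_mx u v)).

Lemma cylinder_col u v : A (col_mx u v) <-> X u.
Proof. by rewrite /A /cylinder /= col_mxKu. Qed.

Let Acol u v : X u -> A (col_mx u v). Proof. by move/(cylinder_col u v). Qed.

Lemma L_ge0 : 0 <= L.
Proof. by rewrite divr_ge0// ltW. Qed.

Lemma col_mx_move (u a : 'cV[R]_d1) (v b : 'cV[R]_d2) s :
  col_mx u v + s *: col_mx a b = col_mx (u + s *: a) (v + s *: b).
Proof. by rewrite scale_col_mx add_col_mx. Qed.

Lemma col_mxB (u a : 'cV[R]_d1) (v b : 'cV[R]_d2) :
  col_mx u v - col_mx a b = col_mx (u - a) (v - b).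
Proof. by rewrite opp_col_mx add_col_mx. Qed.

Lemma grad_xB (G G' : 'cV[R]_(d1 + d2)) :
  grad_x G - grad_x G' = grad_x (G - G').
Proof. by apply/matrixP => i j; rewrite !mxE. Qed.

Lemma grad_yB (G G' : 'cV[R]_(d1 + d2)) :
  grad_y G - grad_y G' = grad_y (G - G').
Proof. by apply/matrixP => i j; rewrite !mxE. Qed.

Lemma norm2_col_y (u : 'cV[R]_d1) (v w : 'cV[R]_d2) :
  norm2 (col_mx u v - col_mx u w) = norm2 (v - w).
Proof. by rewrite col_mxB subrr norm2_col_0mx. Qed.

Lemma slice_gradient u v : X u ->
  gradient_within setT (fun v => g (col_mx u v)) v (Gy u v).
Proof.
move=> Xu e e0; have /nbhs_ballP[d /= d0 hd] := grad_g (Acol v Xu) e0.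
apply/nbhs_ballP; exists d => //= w [_ vw] _.
have := hd (col_mx u w); rewrite norm2_col_y /= => /(_ _ (Acol w Xu)).
rewrite col_mxB subrr -{1}(vsubmxK (gradg _)) dot_col_mx (dotC _ 0) dot0l add0r.
apply; split=> // i j; rewrite !mxE.
case: (fintype.split i) => k; last exact: vw.
exact: ballxx.
Qed.

Lemma slice_lip u v w : X u -> norm2 (Gy u v - Gy u w) <= lg1 * norm2 (v - w).
Proof.
move=> Xu; rewrite -(norm2_col_y u v w) /Gy grad_yB.
apply: le_trans (norm2_dsubmx _) _; exact: lip_gradg (Acol _ Xu) (Acol _ Xu).
Qed.

Lemma slice_strongly_monotone u (v w : 'cV[R]_d2) : X u ->
  mug * norm2 (w - v) ^+ 2 <= dot (Gy u w - Gy u v) (w - v).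
Proof.
move=> Xu.
exact: (strongly_monotone (fun v => slice_gradient v Xu) (sc_g Xu)).
Qed.

(** L = 0 means lg1 = 0, and a function cannot be both affine and strongly
    convex in y unless its domain is a point. *)
Lemma norm2_inner_diff0 u (v w : 'cV[R]_d2) : X u -> L = 0 -> norm2 (v - w) = 0.
Proof.
move=> Xu /eqP; rewrite mulf_eq0 invr_eq0 (gt_eqF mug_gt0) orbF => /eqP lg10.
have := le_trans (slice_strongly_monotone w v Xu) (dot_le_norm2 _ _).
move=> /le_trans /(_ (ler_wpM2r (norm2_ge0 (v - w)) (slice_lip v w Xu))).
rewrite lg10 !mul0r pmulr_rle0// => h.
by apply/eqP; rewrite -sqrf_eq0; apply/eqP/le_anti; rewrite h sqr_ge0.
Qed.

Lemma Gy_ystar u : X u -> Gy u (ystar u) = 0.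
Proof.
move=> Xu.
apply: (gradient_at_minimizer lg1_ge0 (fun v => slice_gradient v Xu)).
  by move=> v w; apply: slice_lip.
exact: ystarP.
Qed.

Lemma inner_gd_rate u v K B : X u -> 0 < B ->
  4^-1 * (lg1 / mug + 1) * ln B <= K%:R ->
  B * norm2 (iter K (fun z => z - (2 / (lg1 + mug)) *: Gy u z) v - ystar u) ^+ 2
    <= norm2 (v - ystar u) ^+ 2.
Proof.
move=> Xu; apply: (gd_iter_rate mug_gt0 lg1_ge0
  (fun v => slice_gradient v Xu) (sc_g Xu) _ (ystarP Xu)).
by move=> w w'; apply: slice_lip.
Qed.

(** Strong monotonicity of grad_y g(u, .) bounds the distance of the two
    minimizers by the gradient at ystar(u') of g(u, .), which differs from the
    vanishing gradient of g(u', .) by at most lg1 |u - u'|. *)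
Lemma ystar_lipschitz u u' : X u -> X u' ->
  norm2 (ystar u - ystar u') <= L * norm2 (u - u').
Proof.
move=> Xu Xu'; rewrite (norm2C u) (norm2C (ystar u)).
have := norm2_ge0 (ystar u' - ystar u); rewrite le_eqVlt => /orP[/eqP<-|y0].
  by rewrite mulr_ge0 ?L_ge0 ?norm2_ge0.
have := slice_strongly_monotone (ystar u) (ystar u') Xu.
rewrite (Gy_ystar Xu) -(Gy_ystar Xu') => /le_trans /(_ (dot_le_norm2 _ _)).
have : norm2 (Gy u (ystar u') - Gy u' (ystar u')) <= lg1 * norm2 (u' - u).
  rewrite /Gy grad_yB; apply: le_trans (norm2_dsubmx _) _.
  apply: le_trans (lip_gradg (Acol _ Xu) (Acol _ Xu')) _.
  by rewrite col_mxB subrr norm2_col_mx0 norm2C.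
move=> /(ler_wpM2r (ltW y0)) h1 h2; have := le_trans h2 h1.
by rewrite expr2 mulrA ler_pM2r// /L mulrAC ler_pdivlMr// mulrC.
Qed.

Section AtPoint.
Variables (u : 'cV[R]_d1) (v : 'cV[R]_d2).
Hypothesis Xu : X u.
Let z := col_mx u v.
Let H := hessg z.
Let Az : A z := Acol v Xu.

Lemma hess_col (a : 'cV[R]_d1) (b : 'cV[R]_d2) :
  H *m col_mx a b = col_mx (ulsubmx H *m a + hess_xy H *m b)
                           (dlsubmx H *m a + hess_yy H *m b).
Proof. by rewrite -{1}(submxK H) mul_block_col. Qed.

Lemma seg_y b s : 0 <= s <= 1 -> A (z + s *: col_mx 0 b).
Proof. by move=> _; rewrite col_mx_move scaler0 addr0; apply: Acol. Qed.

Lemma seg_x u' s : X u' -> 0 <= s <= 1 -> A (z + s *: col_mx (u' - u) 0).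
Proof. by move=> Xu' s01; rewrite col_mx_move; apply/Acol/segX. Qed.

Lemma hess_xy_le (b : 'cV[R]_d2) : norm2 (hess_xy H *m b) <= lg1 * norm2 b.
Proof.
have := jacobian_direction_le (hess_g Az) (seg_y b)
  (fun w Aw => lip_gradg Aw Az).
rewrite norm2_col_0mx hess_col !mulmx0 !add0r; apply: le_trans.
by rewrite -{1}(col_mxKu (hess_xy H *m b) (hess_yy H *m b)) norm2_usubmx.
Qed.

(** Strong monotonicity of grad_y g along the segment from v in the direction
    b, divided by the square of its length. *)
Lemma hess_yy_coercive b : mug * norm2 b ^+ 2 <= dot b (hess_yy H *m b).
Proof.
apply/ler_addgt0Pr => e e0; have N0 : 0 < 1 + norm2 b.
  by rewrite ltr_pwDl ?norm2_ge0.
have [s /andP[s0 s1]] :=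
  jacobian_direction (hess_g Az) (seg_y b) (divr_gt0 e0 N0).
rewrite -/H hess_col !mulmx0 !add0r col_mx_move scaler0 addr0.
set G1 := gradg _; set G0 := gradg _ => hs.
have {hs} hs : norm2 (grad_y G1 - grad_y G0 - s *: (hess_yy H *m b)) <=
    s * (e / (1 + norm2 b)).
  apply: le_trans hs; apply: le_trans (norm2_dsubmx _).
  rewrite -[X in _ - X](col_mxKd (s *: (hess_xy H *m b))) !grad_yB.
  by rewrite scale_col_mx.
have := slice_strongly_monotone v (v + s *: b) Xu.
have -> : v + s *: b - v = s *: b by rewrite addrAC subrr add0r.
rewrite -/G1 /Gy -/z -/G0 norm2Z gtr0_norm// dotZr => mono.
have := dot_le_norm2 (grad_y G1 - grad_y G0 - s *: (hess_yy H *m b)) b.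
move=> /le_trans /(_ (ler_wpM2r (norm2_ge0 b) hs)).
rewrite dotBl (dotZl s) (dotC (_ *m b)) => up.
have eb : e / (1 + norm2 b) * norm2 b <= e.
  by rewrite mulrAC ler_pdivrMr// ler_pM2l// lerDr.
rewrite -(ler_pM2l s0).
have : mug * norm2 b ^+ 2 * s <= dot (grad_y G1 - grad_y G0) b.
  by rewrite -(ler_pM2l s0); apply: le_trans mono; rewrite le_eqVlt;
    apply/orP; left; apply/eqP; ring.
have := ler_wpM2l (ltW s0) eb; lra.
Qed.

Lemma hess_yy_onto w :
  exists2 b, hess_yy H *m b = w & norm2 b <= norm2 w / mug.
Proof. exact: coercive_onto mug_gt0 hess_yy_coercive w. Qed.

Lemma M_hess_yy (b : 'cV[R]_d2) : M z *m (hess_yy H *m b) = - (hess_xy H *m b).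
Proof.
rewrite mulmxA; have /eqP := M_eq Az; rewrite addr_eq0 => /eqP ->.
by rewrite mulNmx.
Qed.

(** Every w is hess_yy b, on which M acts as - hess_xy; this replaces the
    formula M = - hess_xy hess_yy^-1. *)
Lemma M_le (w : 'cV[R]_d2) : norm2 (M z *m w) <= L * norm2 w.
Proof.
have [b <- hb] := hess_yy_onto w; rewrite M_hess_yy norm2N.
apply: le_trans (hess_xy_le b) _.
by rewrite /L -mulrA ler_wpM2l// mulrC.
Qed.

Lemma grad_y_f_le : norm2 (grad_y (gradf z)) <= lf0.
Proof.
set G := grad_y (gradf z).
have := norm2_ge0 G; rewrite le_eqVlt => /orP[/eqP<-//|G0].
have := gradient_direction_le (grad_f Az) (seg_y G) (fun w Aw => lip_f Aw Az).
rewrite norm2_col_0mx -{1}(vsubmxK (gradf z)) dot_col_mx (dotC _ 0) dot0l add0r.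
rewrite -[dsubmx (gradf z)]/G -norm2_sqr ger0_norm ?sqr_ge0// expr2.
by rewrite ler_pM2r.
Qed.

(** The x-part of the gradient of f need not be bounded, as it is arbitrary in
    the directions orthogonal to X; its pairing with a difference of points of
    X is, because f is Lipschitz along the segment between them. *)
Lemma hypergrad_feasible_le u' : X u' ->
  `|dot (approx_hypergrad (gradf z) (M z)) (u' - u)| <=
  lf0 * (1 + L) * norm2 (u' - u).
Proof.
move=> Xu'; rewrite /approx_hypergrad dotDl; apply: le_trans (ler_normD _ _) _.
have h1 : `|dot (grad_x (gradf z)) (u' - u)| <= lf0 * norm2 (u' - u).
  have := gradient_direction_le (grad_f Az) (fun s => seg_x Xu')
    (fun w Aw => lip_f Aw Az).
  rewrite norm2_col_mx0 -{1}(vsubmxK (gradf z)).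
  by rewrite dot_col_mx (dotC _ 0) dot0l addr0.
have h2 : `|dot (M z *m grad_y (gradf z)) (u' - u)| <= L * lf0 * norm2 (u' - u).
  apply: le_trans (norm_dot_le _ _) _; apply: ler_wpM2r; first exact: norm2_ge0.
  apply: le_trans (M_le _) _.
  by apply: ler_wpM2l; [exact: L_ge0|exact: grad_y_f_le].
by lra.
Qed.

Lemma hess_yy_symm a b : dot a (hess_yy H *m b) = dot b (hess_yy H *m a).
Proof.
have seg r s : 0 <= r <= 1 -> 0 <= s <= 1 ->
    A (z + r *: col_mx 0 a + s *: col_mx 0 b).
  by move=> _ _; rewrite !col_mx_move !scaler0 !addr0; apply: Acol.
have := second_derivative_symm grad_g (hess_g Az) seg.
by rewrite -/H !hess_col !dot_col_mx !dot0l !mulmx0 !add0r.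
Qed.

(** The direction in x is a difference of points of X, since the Jacobian is
    not determined in directions that leave X. *)
Lemma hess_xy_symm u' b : X u' ->
  dot (u' - u) (hess_xy H *m b) = dot b (dlsubmx H *m (u' - u)).
Proof.
move=> Xu'.
have seg r s : 0 <= r <= 1 -> 0 <= s <= 1 ->
    A (z + r *: col_mx (u' - u) 0 + s *: col_mx 0 b).
  by move=> r01 _; rewrite !col_mx_move !scaler0 !addr0; apply/Acol/segX.
have := second_derivative_symm grad_g (hess_g Az) seg.
by rewrite -/H !hess_col !dot_col_mx !dot0l !mulmx0 !addr0 !add0r.
Qed.

End AtPoint.

(** For w = hess_yy(z') b, the defining equations of M z and M z' give
    (M z - M z') w = - Ex - (M z) Ey, where Ex and Ey are the increments of the
    two blocks of the Hessian, applied to b. *)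
Lemma M_lipschitz u v u' v' w : X u -> X u' ->
  norm2 ((M (col_mx u v) - M (col_mx u' v')) *m w) <=
  (lg2 + L * lg2) / mug * norm2 (col_mx u v - col_mx u' v') * norm2 w.
Proof.
move=> Xu Xu'; set z := col_mx u v; set z' := col_mx u' v'.
have [b wb hb] := hess_yy_onto v' Xu' w; rewrite -/z' in wb.
pose Dlt := hessg z - hessg z'.
have DltE : Dlt *m col_mx 0 b =
    col_mx (hess_xy (hessg z) *m b - hess_xy (hessg z') *m b)
           (hess_yy (hessg z) *m b - hess_yy (hessg z') *m b).
  by rewrite mulmxBl !hess_col !mulmx0 !add0r col_mxB.
have Dltb : norm2 (Dlt *m col_mx 0 b) <= lg2 * norm2 (z - z') * norm2 b.
  apply: le_trans (le_opnorm2 _ _) _; rewrite norm2_col_0mx.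
  apply: ler_wpM2r; first exact: norm2_ge0.
  exact: lip_hessg (Acol _ Xu) (Acol _ Xu').
set D := lg2 * norm2 (z - z') * norm2 b in Dltb.
set Ex := hess_xy _ *m b - hess_xy _ *m b in DltE *.
set Ey := hess_yy _ *m b - hess_yy _ *m b in DltE *.
have Dx : norm2 Ex <= D.
  by apply: le_trans Dltb; rewrite DltE -{1}(col_mxKu Ex Ey) norm2_usubmx.
have Dy : norm2 Ey <= D.
  by apply: le_trans Dltb; rewrite DltE -{1}(col_mxKd Ex Ey) norm2_dsubmx.
have -> : (M z - M z') *m w = - Ex - M z *m Ey.
  rewrite /Ex /Ey -wb mulmxBl (mulmxBr (M z)) (M_hess_yy v Xu).
  rewrite (M_hess_yy v' Xu') -/z -/z'.
  by apply/matrixP => i j; rewrite !mxE; ring.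
apply: le_trans (norm2D _ _) _; rewrite !norm2N.
have LD := le_trans (M_le v Xu _) (ler_wpM2l L_ge0 Dy).
apply: le_trans (lerD Dx LD) _.
have -> : D + L * D = (lg2 + L * lg2) * norm2 (z - z') * norm2 b.
  by rewrite /D; ring.
have -> : (lg2 + L * lg2) / mug * norm2 (z - z') * norm2 w =
  (lg2 + L * lg2) * norm2 (z - z') * (norm2 w / mug) by ring.
apply: ler_wpM2l => //; apply: mulr_ge0; last exact: norm2_ge0.
by apply: addr_ge0 => //; apply: mulr_ge0 => //; exact: L_ge0.
Qed.

(** The three summands of [M_f] come from the increment of grad_x f, of
    grad_y f under M, and of M itself. *)
Lemma hypergrad_error u v : X u ->
  norm2 (approx_hypergrad (gradf (col_mx u v)) (M (col_mx u v)) -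
         approx_hypergrad (gradf (col_mx u (ystar u))) (M (col_mx u (ystar u))))
  <= M_f lf0 lf1 lg1 lg2 mug * norm2 (v - ystar u).
Proof.
move=> Xu; set z := col_mx u v; set z' := col_mx u (ystar u).
have zz : norm2 (v - ystar u) = norm2 (z - z') by rewrite norm2_col_y.
rewrite zz.
have gx : norm2 (grad_x (gradf z) - grad_x (gradf z')) <= lf1 * norm2 (z - z').
  rewrite grad_xB; apply: le_trans (norm2_usubmx _) _.
  exact: lip_gradf (Acol _ Xu) (Acol _ Xu).
have gy : norm2 (grad_y (gradf z) - grad_y (gradf z')) <= lf1 * norm2 (z - z').
  rewrite grad_yB; apply: le_trans (norm2_dsubmx _) _.
  exact: lip_gradf (Acol _ Xu) (Acol _ Xu).
have -> : approx_hypergrad (gradf z) (M z) -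
    approx_hypergrad (gradf z') (M z') =
    (grad_x (gradf z) - grad_x (gradf z')) +
    (M z *m (grad_y (gradf z) - grad_y (gradf z')) +
     (M z - M z') *m grad_y (gradf z')).
  rewrite /approx_hypergrad mulmxBr mulmxBl.
  by apply/matrixP => i j; rewrite !mxE; ring.
apply: le_trans (norm2D _ _) _.
have t2 := le_trans (M_le v Xu _) (ler_wpM2l L_ge0 gy).
have cst_ge0 : 0 <= (lg2 + L * lg2) / mug * norm2 (z - z').
  apply: mulr_ge0; last exact: norm2_ge0.
  by rewrite divr_ge0 ?(ltW mug_gt0)// addr_ge0// mulr_ge0 ?L_ge0.
have t3 := le_trans (M_lipschitz v (ystar u) (grad_y (gradf z')) Xu Xu)
  (ler_wpM2l cst_ge0 (grad_y_f_le (ystar u) Xu)).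
apply: le_trans (lerD gx (le_trans (norm2D _ _) (lerD t2 t3))) _.
by rewrite le_eqVlt; apply/orP; left; apply/eqP; rewrite /M_f /L; ring.
Qed.

(** The chain rule for u |-> f(u, ystar u) in the direction d = u' - u.  If dy
    is the increment of ystar, then hess_yx (s d) + hess_yy dy = o(s) because
    grad_y g vanishes at both ends.  Writing grad_y f = hess_yy p, symmetry of
    the Hessian gives <grad_y f, dy> = <p, hess_yy dy> =
    - s <p, hess_yx d> + o(s) = - s <hess_xy p, d> + o(s)
    = s <M grad_y f, d> + o(s). *)
Lemma outer_above_tangent u u' :
  strongly_convex muf X (fun u => f (col_mx u (ystar u))) -> X u -> X u' ->
  f (col_mx u (ystar u)) +
    dot (approx_hypergrad (gradf (col_mx u (ystar u))) (M (col_mx u (ystar u))))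
        (u' - u) + muf / 2 * norm2 (u' - u) ^+ 2 <= f (col_mx u' (ystar u')).
Proof.
move=> scF Xu Xu'; apply: (strongly_convex_above_tangent scF) => // e e0.
set z := col_mx u (ystar u); pose H := hessg z.
have Az : A z := Acol _ Xu.
have [p pE _] := hess_yy_onto (ystar u) Xu (grad_y (gradf z)).
have p0 := norm2_ge0 p.
pose N := 1 + (1 + L) * norm2 (u' - u).
have N0 : 0 < N.
  by rewrite ltr_pwDl// mulr_ge0 ?norm2_ge0// addr_ge0 ?L_ge0.
have e10 : 0 < e / (2 * N) by rewrite divr_gt0// mulr_gt0.
have e20 : 0 < e / (2 * N * (1 + norm2 p)).
  by rewrite divr_gt0// !mulr_gt0// ltr_pwDl.
have [D1 D10 hD1] := gradient_withinP (grad_f Az) e10.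
have [D2 D20 hD2] := jacobian_withinP (hess_g Az) e20.
exists (Num.min D1 D2 / N) => [|s /andP[s0 s1]].
  by rewrite divr_gt0// lt_min D10.
rewrite ltr_pdivlMr// lt_min => /andP[sD1 sD2].
have s01 : 0 <= s <= 1 by rewrite ltW.
set us := u + s *: (u' - u); have Xus : X us by apply: segX.
have Aw : A (col_mx us (ystar us)) := Acol _ Xus.
set w := col_mx us (ystar us) in Aw *; pose dy := ystar us - ystar u.
have usu : us - u = s *: (u' - u) by rewrite /us addrAC subrr add0r.
have wz : w - z = col_mx (s *: (u' - u)) dy by rewrite col_mxB usu.
have nwz : norm2 (w - z) <= s * N.
  rewrite wz; apply: le_trans (norm2_col_mx_le _ _) _.
  have := ystar_lipschitz Xus Xu; rewrite -/dy usu norm2Z gtr0_norm//.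
  by rewrite /N => h; have := mulr_gt0 s0 ltr01; lra.
have := hD1 w Aw (le_lt_trans nwz sD1); have := hD2 w Aw (le_lt_trans nwz sD2).
have gw : grad_y (gradg w) = 0 := Gy_ystar Xus.
have gz : grad_y (gradg z) = 0 := Gy_ystar Xu.
move=> hH hf.
have {hH} hH : norm2 (s *: (dlsubmx H *m (u' - u)) + hess_yy H *m dy) <=
    e / (2 * N * (1 + norm2 p)) * (s * N).
  apply: le_trans (ler_wpM2l (ltW e20) nwz); apply: le_trans hH.
  apply: le_trans (norm2_dsubmx _); rewrite wz hess_col -!/(grad_y _).
  rewrite -!grad_yB gw gz subrr sub0r norm2N.
  rewrite /grad_y col_mxKd.
  by rewrite -scalemxAr.
have {hf} := le_trans hf (ler_wpM2l (ltW e10) nwz).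
rewrite wz -{1}(vsubmxK (gradf z)) dot_col_mx.
rewrite -/(grad_x _) -/(grad_y _) => hf.
have hy : `|dot (grad_y (gradf z)) dy -
    s * dot (M z *m grad_y (gradf z)) (u' - u)| <= s * (e / 2).
  have -> : dot (grad_y (gradf z)) dy -
      s * dot (M z *m grad_y (gradf z)) (u' - u) =
      dot p (s *: (dlsubmx H *m (u' - u)) + hess_yy H *m dy).
    rewrite -pE (M_hess_yy _ Xu) (dotC _ dy) (hess_yy_symm _ Xu) dotNl.
    rewrite (dotC _ (u' - u)) (hess_xy_symm _ Xu)// mulrN opprK addrC.
    by rewrite dotDr dotZr.
  apply: le_trans (norm_dot_le _ _) _.
  apply: le_trans (ler_wpM2l p0 hH) _.
  have -> : norm2 p * (e / (2 * N * (1 + norm2 p)) * (s * N)) =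
      s * (e / 2) * (norm2 p / (1 + norm2 p)).
    by field; rewrite !gt_eqF// ltr_pwDl.
  have se0 : 0 <= s * (e / 2) by rewrite ltW// mulr_gt0// divr_gt0.
  rewrite ler_piMr//.
  have p10 : 0 < 1 + norm2 p by rewrite ltr_pwDl.
  by rewrite ler_pdivrMr// mul1r lerDr.
have eN : e / (2 * N) * (s * N) = s * (e / 2) by field; rewrite gt_eqF.
rewrite eN in hf; rewrite /approx_hypergrad dotDl.
move: hf hy; rewrite dotZr !ler_norml; lra.
Qed.

(** The gradient error is split by Young's inequality so that it takes
    muf / 8 out of the muf / 2 provided by strong convexity. *)
Lemma round_regret u u' w v t :
  let F u := f (col_mx u (ystar u)) in
  let z := col_mx u v in
  let G := lf0 * (1 + L) in
  0 < muf -> strongly_convex muf X F -> (0 < t)%N -> X u -> X w ->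
  is_minimizer X (fun r => norm2
    (r - (u - (2 / (muf * t%:R)) *: approx_hypergrad (gradf z) (M z)))) u' ->
  F u - F w <= - (3 / 8) * muf * norm2 (u - w) ^+ 2 +
    2 * M_f lf0 lf1 lg1 lg2 mug ^+ 2 / muf * norm2 (v - ystar u) ^+ 2 +
    muf / 4 * (t%:R * (norm2 (u - w) ^+ 2 - norm2 (u' - w) ^+ 2)) +
    G ^+ 2 / muf * t%:R^-1.
Proof.
move=> F z G muf0 scF t0 Xu Xw proj.
have t0' : 0 < t%:R :> R by rewrite ltr0n.
have a0 : 0 < 2 / (muf * t%:R) by rewrite divr_gt0// mulr_gt0.
have Xu' : X u' := proj.1.
have feas := hypergrad_feasible_le v Xu Xu'.
have := projected_step_regret segX a0 Xu proj feas Xw.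
have := outer_above_tangent scF Xu Xw; have := hypergrad_error v Xu.
rewrite -/(F u) -/(F w) -/z -/G -(opprB u w) dotNr norm2N.
set h := approx_hypergrad (gradf z) _.
set h' := approx_hypergrad _ (M (col_mx u (ystar u))).
set Mf := M_f _ _ _ _ _ => err tangent step.
(* h' is the exact gradient of F at u. *)
have split_grad : dot h' (u - w) <=
    dot h (u - w) + Mf * norm2 (v - ystar u) * norm2 (u - w).
  have := dot_le_norm2 (h' - h) (u - w); rewrite (norm2C h' h).
  have := ler_wpM2r (norm2_ge0 (u - w)) err.
  by rewrite dotBl; lra.
have young : Mf * norm2 (v - ystar u) * norm2 (u - w) <=
    muf / 8 * norm2 (u - w) ^+ 2 + 2 * Mf ^+ 2 / muf * norm2 (v - ystar u) ^+ 2.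
  rewrite -subr_ge0.
  have -> : muf / 8 * norm2 (u - w) ^+ 2 +
      2 * Mf ^+ 2 / muf * norm2 (v - ystar u) ^+ 2 -
      Mf * norm2 (v - ystar u) * norm2 (u - w) =
      (muf * norm2 (u - w) - 4 * Mf * norm2 (v - ystar u)) ^+ 2 / (8 * muf).
    by field; rewrite gt_eqF.
  by rewrite divr_ge0 ?sqr_ge0// mulr_ge0// ltW.
have stepE : (norm2 (u - w) ^+ 2 - norm2 (u' - w) ^+ 2) /
    (2 * (2 / (muf * t%:R))) + 2 / (muf * t%:R) * G ^+ 2 / 2 =
    muf / 4 * (t%:R * (norm2 (u - w) ^+ 2 - norm2 (u' - w) ^+ 2)) +
    G ^+ 2 / muf * t%:R^-1.
  by field; rewrite !gt_eqF.
rewrite stepE in step.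
lra.
Qed.

End Bilevel.

(** * Summing the rounds *)
Section RegretRecursion.
Variable R : realType.

(** Summation by parts. *)
Lemma sum_weighted_differences (a : nat -> R) T :
  \sum_(1 <= t < T.+1) t%:R * (a t - a t.+1) =
  \sum_(1 <= t < T.+1) a t - T%:R * a T.+1.
Proof.
elim: T => [|T IH]; first by rewrite !big_geq// mul0r subrr.
by rewrite !(big_nat_recr T.+1)//= IH -natr1; ring.
Qed.

Lemma harmonic_le_ln T : (1 <= T)%N ->
  \sum_(1 <= t < T.+1) t%:R^-1 <= 1 + ln T%:R :> R.
Proof.
elim: T => [//|T IH] _.
have [->|T0] := posnP T; first by rewrite big_nat1 ln1 invr1 addr0.
rewrite big_nat_recr//=; have := IH T0.
have T1 : 0 < T%:R :> R by rewrite ltr0n.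
have T2 : 0 < T.+1%:R :> R by rewrite ltr0n.
have : ln (T%:R / T.+1%:R : R) <= - T.+1%:R^-1.
  have -> : T%:R / T.+1%:R = 1 + - T.+1%:R^-1 :> R.
    by rewrite -natr1 in T2 *; field; rewrite gt_eqF.
  apply: le_ln1Dx; rewrite ltrN2 invf_lt1// ltr1n; exact: T0.
rewrite ln_div ?posrE//; move: (ln _) (ln T.+1%:R) (T.+1%:R^-1) => l l' i.
by move=> h1 h2; lra.
Qed.

(** In the application a, th, e, p are squared distances: of x_t to xstar, of
    y_(t+1) and of y_t to the inner solution at x_t, and between consecutive
    inner solutions at xstar. *)
Lemma tracking_sum (a th e p : nat -> R) L T : (1 <= T)%N ->
  (forall t, (1 <= t < T)%N -> e t.+1 <=
    2 * th t + 6 * L ^+ 2 * a t + 6 * p t.+1 + 6 * L ^+ 2 * a t.+1) ->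
  (forall t, (1 <= t <= T)%N -> 0 <= a t /\ 0 <= th t) ->
  \sum_(1 <= t < T.+1) e t <= e 1%N + 2 * \sum_(1 <= t < T.+1) th t +
    12 * L ^+ 2 * \sum_(1 <= t < T.+1) a t + 6 * \sum_(2 <= t < T.+1) p t.
Proof.
move=> T1 he a0.
(* The two extra terms on the left absorb, in the induction step, what the
   recursion needs from the previous index. *)
suff main k : (k < T)%N -> \sum_(1 <= t < k.+2) e t + 2 * th k.+1 +
    6 * L ^+ 2 * a k.+1 <= e 1%N + 2 * \sum_(1 <= t < k.+2) th t +
    12 * L ^+ 2 * \sum_(1 <= t < k.+2) a t + 6 * \sum_(2 <= t < k.+2) p t.
  case: T T1 he a0 main => // T _ _ a0 main.
  have [aT thT] := a0 T.+1 (leqnn _).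
  have := main T (leqnn _); have := mulr_ge0 (sqr_ge0 L) aT; lra.
elim: k => [|k IH] kT.
  rewrite !big_nat1 big_geq//; have [a1 _] := a0 1%N kT.
  by have := mulr_ge0 (sqr_ge0 L) a1; lra.
have := IH (ltnW kT); have := he k.+1 kT.
rewrite !(big_nat_recr k.+2)//=; lra.
Qed.

(** Since th_t <= e_t / (A^2 + 2) with A = 24 L Mf / muf, [tracking_sum] yields
    A^2 sum th <= D2 + 12 L^2 sum a + 6 sum p.  The coefficient 2 Mf^2 / muf
    of sum th is A^2 muf / (288 L^2), so that the share of sum a is muf / 24,
    which is less than the muf / 8 left over by the other terms. *)
Lemma regret_recursion (muf Mf L G D2 : R) (r a th e p : nat -> R) T :
  0 < muf -> 0 <= L -> (1 <= T)%N ->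
  (forall t, (1 <= t <= T.+1)%N -> 0 <= a t) ->
  (forall t, (1 <= t <= T)%N -> [/\ 0 <= th t, 0 <= p t & L = 0 -> th t = 0]) ->
  (forall t, (1 <= t <= T)%N ->
    r t <= - (3 / 8) * muf * a t + 2 * Mf ^+ 2 / muf * th t +
           muf / 4 * (t%:R * (a t - a t.+1)) + G ^+ 2 / muf * t%:R^-1) ->
  (forall t, (1 <= t <= T)%N -> ((24 * L * Mf / muf) ^+ 2 + 2) * th t <= e t) ->
  (forall t, (1 <= t < T)%N -> e t.+1 <=
    2 * th t + 6 * L ^+ 2 * a t + 6 * p t.+1 + 6 * L ^+ 2 * a t.+1) ->
  e 1%N <= D2 ->
  \sum_(1 <= t < T.+1) r t <=
    muf / (288 * L ^+ 2) * (D2 + 6 * \sum_(2 <= t < T.+1) p t) +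
    G ^+ 2 / muf * (1 + ln T%:R).
Proof.
move=> mu0 L0 T1 a0 thp hr hth he e1.
set Sp := \sum_(2 <= t < _) p t.
set Sa := \sum_(1 <= t < T.+1) a t; set St := \sum_(1 <= t < T.+1) th t.
have Sa0 : 0 <= Sa.
  rewrite /Sa big_nat; apply: sumr_ge0 => t tT.
  by apply: a0; case/andP: tT => -> /ltnW.
have St0 : 0 <= St.
  by rewrite /St big_nat; apply: sumr_ge0 => t tT; case: (thp t tT).
have Sp0 : 0 <= Sp.
  rewrite /Sp big_nat; apply: sumr_ge0 => t /andP[/ltnW t1 tT].
  by case: (thp t) => //; rewrite t1.
have aT : 0 <= T%:R * a T.+1 by rewrite mulr_ge0 ?ler0n ?a0//= leqnn.
have sumr : \sum_(1 <= t < T.+1) r t <= - (3 / 8) * muf * Sa +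
    2 * Mf ^+ 2 / muf * St + muf / 4 * (Sa - T%:R * a T.+1) +
    G ^+ 2 / muf * \sum_(1 <= t < T.+1) t%:R^-1.
  rewrite -sum_weighted_differences /Sa /St !mulr_sumr -!big_split/=.
  by apply: ler_sum_nat => t tT; apply: hr.
have hharm := harmonic_le_ln T1.
have G0 : 0 <= G ^+ 2 / muf by rewrite divr_ge0 ?sqr_ge0// ltW.
have {}hharm := ler_wpM2l G0 hharm.
have muaT := mulr_ge0 (ltW mu0) aT.
have muSa := mulr_ge0 (ltW mu0) Sa0.
have D20 : 0 <= D2.
  apply: le_trans e1; apply: le_trans (hth 1%N T1).
  by rewrite mulr_ge0 ?addr_ge0 ?sqr_ge0//; case: (thp 1%N T1).
have rest0 : 0 <= muf / (288 * L ^+ 2) * (D2 + 6 * Sp).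
  apply: mulr_ge0; first by rewrite divr_ge0 ?mulr_ge0 ?sqr_ge0// ltW.
  by lra.
suff key : 2 * Mf ^+ 2 / muf * St <=
    muf / (288 * L ^+ 2) * (D2 + 6 * Sp) + muf / 24 * Sa by lra.
(* The weight muf / (288 L^2) is informative only for L <> 0. *)
have [Lz|Ln0] := eqVneq L 0.
  have -> : St = 0.
    by rewrite /St big_nat; apply: big1 => t tT; case: (thp t tT) => _ _; apply.
  by rewrite mulr0; lra.
have ath t : (1 <= t <= T)%N -> 0 <= a t /\ 0 <= th t.
  by move=> tT; split; [apply: a0; case/andP: tT => -> /leqW|case: (thp t tT)].
have := tracking_sum T1 he ath; rewrite -/Sa -/St -/Sp => track.
have Se : ((24 * L * Mf / muf) ^+ 2 + 2) * St <= \sum_(1 <= t < T.+1) e t.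
  by rewrite /St mulr_sumr; apply: ler_sum_nat => t tT; apply: hth.
have ASt : (24 * L * Mf / muf) ^+ 2 * St <= D2 + 12 * L ^+ 2 * Sa + 6 * Sp.
  by lra.
have L20 : 0 < L ^+ 2 by rewrite exprn_even_gt0.
have c0 : 0 < muf / (288 * L ^+ 2) by rewrite divr_gt0// mulr_gt0.
have := ler_wpM2l (ltW c0) ASt.
have -> : muf / (288 * L ^+ 2) * ((24 * L * Mf / muf) ^+ 2 * St) =
    2 * Mf ^+ 2 / muf * St by field; rewrite (gt_eqF mu0) Ln0.
have -> : muf / (288 * L ^+ 2) * (D2 + 12 * L ^+ 2 * Sa + 6 * Sp) =
    muf / (288 * L ^+ 2) * (D2 + 6 * Sp) + muf / 24 * Sa by field; rewrite Ln0.
by [].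
Qed.

End RegretRecursion.

Lemma convex_set_segment (R : realType) n (X : set 'cV[R]_n) u u' (s : R) :
  convex_set X -> X u -> X u' -> 0 <= s <= 1 -> X (u + s *: (u' - u)).
Proof.
move=> cX Xu Xu' /andP[s0 s1].
have := cX u' u (Itv01 s0 s1); rewrite !inE => /(_ Xu' Xu) h.
suff -> : u + s *: (u' - u) = s *: u' + (1 - s) *: u by exact: h.
by apply/matrixP => i j; rewrite !mxE; ring.
Qed.

Section Tracking.
Variable R : realType.

(** The path goes from y through y0 and the solutions s0, s1 to y1.  The weights
    come from (b + c)^2 <= 2 b^2 + 2 c^2 and
    (b + c + d)^2 <= 3 (b^2 + c^2 + d^2). *)
Lemma tracking_step n (y y0 s0 y1 s1 : 'cV[R]_n) (L a a' : R) :
  0 <= L -> 0 <= a -> 0 <= a' ->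
  norm2 (y0 - s0) <= L * a -> norm2 (s1 - y1) <= L * a' ->
  norm2 (y - y1) ^+ 2 <= 2 * norm2 (y - y0) ^+ 2 + 6 * L ^+ 2 * a ^+ 2 +
    6 * norm2 (s0 - s1) ^+ 2 + 6 * L ^+ 2 * a' ^+ 2.
Proof.
move=> L0 a0 a'0 h0 h1.
have := norm2_triangle y y0 y1; have := norm2_triangle y0 s0 y1.
have := norm2_triangle s0 s1 y1.
have := norm2_ge0 (y - y1); have := norm2_ge0 (y - y0).
have := norm2_ge0 (s0 - s1).
move: (norm2 (y - y1)) (norm2 (y - y0)) (norm2 (s0 - s1)) => e th p.
move=> p0 th0 e0 k1 k2 k3.
have La := mulr_ge0 L0 a0; have La' := mulr_ge0 L0 a'0.
have -> : 6 * L ^+ 2 * a ^+ 2 = 6 * (L * a) ^+ 2 by ring.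
have -> : 6 * L ^+ 2 * a' ^+ 2 = 6 * (L * a') ^+ 2 by ring.
move: (L * a) (L * a') La La' h0 h1 => b b' b0 b'0 h0 h1.
have e_le : e <= th + (b + p + b') by lra.
apply: (@le_trans _ _ ((th + (b + p + b')) ^+ 2)).
  by rewrite ler_pXn2r ?nnegrE//; lra.
have := sqr_ge0 (th - (b + p + b')); have := sqr_ge0 (b - p).
have := sqr_ge0 (p - b'); have := sqr_ge0 (b - b').
nra.
Qed.

End Tracking.

(** * The static regret bound *)
Theorem theorem6 (R : realType) (lf0 lf1 lg1 lg2 muf mug D D' : R) :
  0 <= lf0 -> 0 <= lf1 -> 0 <= lg1 -> 0 <= lg2 -> 0 < muf -> 0 < mug ->
  exists C : R,
  forall (d1 d2 : nat) (X : set 'cV[R]_d1) (T : nat)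
    (f g : nat -> 'cV[R]_(d1 + d2) -> R)
    (gradf gradg : nat -> 'cV[R]_(d1 + d2) -> 'cV[R]_(d1 + d2))
    (hessg : nat -> 'cV[R]_(d1 + d2) -> 'M[R]_(d1 + d2))
    (M : nat -> 'cV[R]_(d1 + d2) -> 'M[R]_(d1, d2))
    (ystar : nat -> 'cV[R]_d1 -> 'cV[R]_d2)
    (x : nat -> 'cV[R]_d1) (y : nat -> 'cV[R]_d2)
    (alpha beta : nat -> R) (Kt : nat -> nat) (K : nat)
    (xstar : 'cV[R]_d1),
  (2 <= T)%N ->
  X !=set0 -> closed X -> convex_set X ->
  (forall t, (1 <= t <= T)%N -> forall z, cylinder d2 X z ->
    [/\ gradient_within (cylinder d2 X) (f t) z (gradf t z),
        gradient_within (cylinder d2 X) (g t) z (gradg t z) &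
        jacobian_within (cylinder d2 X) (gradg t) z (hessg t z)]) ->
  (forall t, (1 <= t <= T)%N -> forall u, X u ->
    is_minimizer setT (fun v => g t (col_mx u v)) (ystar t u)) ->
  (forall t, (1 <= t <= T)%N -> forall z, cylinder d2 X z ->
    M t z *m hess_yy (hessg t z) + hess_xy (hessg t z) = 0) ->
  (forall t, (1 <= t <= T)%N ->
    forall z z', cylinder d2 X z -> cylinder d2 X z' ->
    `|f t z - f t z'| <= lf0 * norm2 (z - z')) ->
  (forall t, (1 <= t <= T)%N -> forall u, X u ->
    strongly_convex mug setT (fun v => g t (col_mx u v))) ->
  (forall t, (1 <= t <= T)%N ->
    forall z z', cylinder d2 X z -> cylinder d2 X z' ->
    [/\ norm2 (gradf t z - gradf t z') <= lf1 * norm2 (z - z'),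
        norm2 (gradg t z - gradg t z') <= lg1 * norm2 (z - z') &
        opnorm2 (hessg t z - hessg t z') <= lg2 * norm2 (z - z')]) ->
  (forall u u', X u -> X u' -> norm2 (u - u') <= D) ->
  norm2 (y 1%N - ystar 1%N (x 1%N)) <= D' ->
  (forall t, (1 <= t <= T)%N -> strongly_convex muf X (outer f ystar t)) ->
  (forall t, (1 <= t <= T)%N ->
    [/\ beta t = 2 / (lg1 + mug), alpha t = 2 / (muf * t%:R) & Kt t = K]) ->
  Num.ceil (4^-1 * (kappa_g lg1 mug + 1) *
    ln ((24 * L_y lg1 mug * M_f lf0 lf1 lg1 lg2 mug / muf) ^+ 2 + 2)) < K%:Z ->
  OAGD_run X T gradf gradg M alpha beta Kt x y ->
  is_minimizer X (fun u => \sum_(1 <= t < T.+1) outer f ystar t u) xstar ->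
  BSReg f ystar x xstar T <= C * (ln T%:R + Ybar2 ystar xstar T).
Proof.
move=> lf0_ge0 _ lg1_ge0 lg2_ge0 muf0 mug0.
set Mf := M_f lf0 lf1 lg1 lg2 mug.
pose L := lg1 / mug; pose G := lf0 * (1 + L).
have L0 : 0 <= L by rewrite divr_ge0// ltW.
pose c := muf / (288 * L ^+ 2).
have ln2 : 0 < ln 2 :> R by rewrite ln_gt0// ltr1n.
(* The bound of [regret_recursion], with its additive constants charged to ln T
   by means of 1 <= ln T / ln 2, which holds for T >= 2. *)
exists (c * (D' ^+ 2 / ln 2 + 6) + G ^+ 2 / muf * ((ln 2)^-1 + 1)).
move=> d1 d2 X T f g gradf gradg hessg M ystar x y alpha beta Kt K xstar.
move=> T2 _ _ convX diff ystarP M_eq lip_f sc_g lip _ y1 scF sched KB.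
move=> [X1 run] [Xs _].
have T1 : (1 <= T)%N by apply: leq_trans T2.
have segX u u' (s : R) : X u -> X u' -> 0 <= s <= 1 -> X (u + s *: (u' - u)).
  exact: convex_set_segment.
have Xx t : (1 <= t <= T.+1)%N -> X (x t).
  case: t => [//|[_ //|t]] /andP[_ tT].
  by have [_ []] := run t.+1 tT.
have grad_f t tT z Az := let: And3 h _ _ := diff t tT z Az in h.
have grad_g t tT z Az := let: And3 _ h _ := diff t tT z Az in h.
have hess_g t tT z Az := let: And3 _ _ h := diff t tT z Az in h.
have lip_gradf t tT z z' Az Az' := let: And3 h _ _ := lip t tT z z' Az Az' in h.
have lip_gradg t tT z z' Az Az' := let: And3 _ h _ := lip t tT z z' Az Az' in h.
have lip_hessg t tT z z' Az Az' := let: And3 _ _ h := lip t tT z z' Az Az' in h.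
set B := (24 * L_y lg1 mug * Mf / muf) ^+ 2 + 2 in KB.
have B0 : 0 < B by rewrite /B ltr_wpDl ?sqr_ge0.
have {}KB : 4^-1 * (lg1 / mug + 1) * ln B <= K%:R.
  by have /ltW := KB; rewrite ceil_le_int.
have T1S t : (1 <= t <= T)%N -> (1 <= t <= T.+1)%N.
  by case/andP=> -> /leqW.
pose a t := norm2 (x t - xstar) ^+ 2.
pose th t := norm2 (y t.+1 - ystar t (x t)) ^+ 2.
pose e t := norm2 (y t - ystar t (x t)) ^+ 2.
pose p t := norm2 (ystar t.-1 xstar - ystar t xstar) ^+ 2.
have main : \sum_(1 <= t < T.+1) (outer f ystar t (x t) - outer f ystar t xstar)
    <= c * (D' ^+ 2 + 6 * \sum_(2 <= t < T.+1) p t) +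
       G ^+ 2 / muf * (1 + ln T%:R).
  apply: (@regret_recursion _ muf Mf L G (D' ^+ 2) _ a th e p) => //.
  - by move=> t _; exact: sqr_ge0.
  - move=> t tT; split; [exact: sqr_ge0|exact: sqr_ge0|move=> Lz].
    rewrite /th (norm2_inner_diff0 mug0 (grad_g t tT) (sc_g t tT)
      (lip_gradg t tT) _ _ (Xx t (T1S t tT)) Lz).
    by rewrite expr0n.
  - move=> t tT; have [bE aE KE] := sched t tT; have [_] := run t tT.
    rewrite /= aE => proj.
    exact: (round_regret lf0_ge0 lg1_ge0 lg2_ge0 mug0 segX
      (grad_f t tT) (grad_g t tT) (hess_g t tT) (ystarP t tT) (M_eq t tT)
      (lip_f t tT) (sc_g t tT) (lip_gradf t tT) (lip_gradg t tT)
      (lip_hessg t tT) muf0 (scF t tT) (proj1 (andP tT)) (Xx t (T1S t tT)) Xs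
      proj).
  - move=> t tT; have [bE aE KE] := sched t tT; have [yE _] := run t tT.
    rewrite /th yE bE KE.
    exact: (inner_gd_rate lg1_ge0 mug0 (grad_g t tT) (ystarP t tT) (sc_g t tT)
      (lip_gradg t tT) (y t) (Xx t (T1S t tT)) B0 KB).
  - move=> t /andP[t1 tT].
    have tT' : (1 <= t <= T)%N by rewrite t1 ltnW.
    have tT1 : (1 <= t.+1 <= T)%N by [].
    rewrite /a; apply: tracking_step => //; rewrite ?norm2_ge0//.
      exact: (ystar_lipschitz lg1_ge0 mug0 (grad_g t tT') (ystarP t tT')
        (sc_g t tT') (lip_gradg t tT') (Xx t (T1S t tT')) Xs).
    rewrite (norm2C (x t.+1)).
    exact: (ystar_lipschitz lg1_ge0 mug0 (grad_g _ tT1) (ystarP _ tT1)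
      (sc_g _ tT1) (lip_gradg _ tT1) Xs (Xx t.+1 (T1S _ tT1))).
  - rewrite /e ler_pXn2r ?nnegrE ?norm2_ge0//.
    exact: le_trans (norm2_ge0 _) y1.
apply: le_trans main _; rewrite -/(Ybar2 ystar xstar T).
set P := Ybar2 _ _ _.
have P0 : 0 <= P by apply: sumr_ge0 => t _; exact: sqr_ge0.
have lnT : ln 2 <= ln T%:R :> R.
  by rewrite ler_ln ?posrE ?ltr0n// ler_nat.
have one_le : 1 <= (ln 2)^-1 * ln T%:R :> R.
  by rewrite mulrC ler_pdivlMr// mul1r.
have c0 : 0 <= c.
  by apply: divr_ge0; [exact: ltW|rewrite mulr_ge0 ?sqr_ge0].
have G0 : 0 <= G ^+ 2 / muf.
  by apply: divr_ge0; [exact: sqr_ge0|exact: ltW].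
have l0 : 0 <= ln T%:R :> R by apply: le_trans lnT; exact: ltW.
have i0 : 0 <= (ln 2 : R)^-1 by rewrite invr_ge0 ltW.
move: (ln T%:R) ((ln 2)^-1) (G ^+ 2 / muf) one_le G0 l0 i0.
move=> l i G' il G'0 l0 i0.
have D0 := sqr_ge0 D'.
have h1 : D' ^+ 2 + 6 * P <= (D' ^+ 2 * i + 6) * (l + P).
  have := ler_wpM2l D0 il; have := mulr_ge0 (mulr_ge0 D0 i0) P0.
  lra.
have h2 : 1 + l <= (i + 1) * (l + P) by have := mulr_ge0 i0 P0; lra.
have := ler_wpM2l c0 h1; have := ler_wpM2l G'0 h2.
lra.
Qed.
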